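(* Let $K$ be an infinite field of characteristic $2$ and let $n\ge r$ be positive integers. Let $\lambda=(a,b,1^d)\in\Lambda^+(n,r)$ and $\mu=(a+d,b)\in\Lambda^+(2,r)$, where $b,d\ge2$. Set $\psi=\sum_{T\in\mathrm{SST}_\lambda(\mu)}\phi_T:D(\lambda)\to\Delta(\mu)$. Then the following are equivalent. (1) $\mathrm{Im}\,\square_\lambda\subseteq\ker\psi$ (hence $\psi$ induces a nonzero map $\Delta(\lambda)\to\Delta(\mu)$). (2) $a$ is even, $b$ is odd and $2^{l_2(\min\{b,d\})}$ divides $a-b+1$. (3) $a$ is even, $b$ is odd and $j_0=0$ is the maximum integer in the interval $[0,\min\{b,d\}]$ of which $\gamma=a-b$ is a 2-complement.
   Context: $V=K^n$ is the natural module of $GL_n(K)$, with natural basis elements denoted $1,\dots,n$; $S=S_K(n,r)$ is the Schur algebra. $\Lambda(n,r)$ is the set of sequences of $n$ nonnegative integers with sum $r$; $\Lambda^+(n,r)$ is the subset of partitions; partitions are padded by zeros when needed and $1^d$ means $d$ parts equal to $1$. $DV=\sum_i D_iV$ is the divided power Hopf algebra of $V$, and $D(\alpha)=D_{\alpha_1}V\otimes\cdots\otimes D_{\alpha_n}V$ for $\alpha\in\Lambda(n,r)$. For a partition $\mu$ with conjugate $\mu'$, the Weyl module $\Delta(\mu)$ is the image of $d'_\mu:D(\mu)\to\Lambda^{\mu'_1}V\otimes\Lambda^{\mu'_2}V\otimes\cdots$, which comultiplies each $D_{\mu_i}V$ into $V^{\otimes\mu_i}$ (one factor per box of row $i$),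 rearranges the factors according to the columns of the diagram, and multiplies each column into the exterior power. For $1\le s\le n-1$ and $1\le t\le\lambda_{s+1}$ let $\lambda(s,t)=(\lambda_1,\dots,\lambda_s+t,\lambda_{s+1}-t,\dots,\lambda_n)$. The map $\square_\lambda:\bigoplus_{s=1}^{n-1}\bigoplus_{t=1}^{\lambda_{s+1}}D(\lambda(s,t))\to D(\lambda)$ restricted to $D(\lambda(s,t))$ is the composition of the comultiplication $D_{\lambda_s+t}V\to D_{\lambda_s}V\otimes D_tV$ in position $s$ and the multiplication $D_tV\otimes D_{\lambda_{s+1}-t}V\to D_{\lambda_{s+1}}V$ (identity on the other factors). The surjection $\pi_{\Delta(\lambda)}:D(\lambda)\to\Delta(\lambda)$ given by $d'_\lambda$ has kernel $\mathrm{Im}\,\square_\lambda$; a map $\psi$ killing $\mathrm{Im}\,\square_\lambda$ induces the map $f$ with $\psi=f\circ\pi_{\Delta(\lambda)}$. A semistandard tableau of shape $\mu$ has entries in $\{1,\dots,n\}$, weakly increasing along rows and strictly increasing down columns; its weight is $(\alpha_1,\dots,\alpha_n)$, $\alpha_i$ being the number of entries $i$. $\mathrm{SST}_\lambda(\mu)$ is the set of semistandard tableaux of shape $\mu$ and weight $\lambda$. For such a $T$ let $a_i$ (resp. $b_i$) be the number of $i$'s in the first (resp. second) row. The $S$-map $\phi_T:D(\lambda)\to\Delta(\mu)$ is the composition of the comultiplications $D_{\lambda_i}V\to D_{a_i}V\otimes D_{b_i}V$, the rearrangement to $(D_{a_1}V\otimes\cdots\otimes D_{a_n}V)\otimes(D_{b_1}V\otimes\cdots\otimes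 D_{b_n}V)$, the multiplications to $D_{\mu_1}V\otimes D_{\mu_2}V=D(\mu)$, and $d'_\mu$. $l_2(y)$ is the least integer $i$ such that $2^i>y$. 2-complements: for nonnegative integers $i,k$, if $i\ge1$ has base 2 representation $\sum_{j=0}^m i_j2^j$ with $i_m=1$, then $k$ is a 2-complement of $i$ if $i+k$ has base 2 representation of the form $\sum_{j\ge m+1}t_j2^j+\sum_{j=0}^m2^j$ with $t_j\in\{0,1\}$; $k$ is a 2-complement of $0$ exactly when $k$ is odd. *)

(* Defs.v *)
From HB Require Import structures.
From mathcomp Require Import all_boot all_algebra.

Set Implicit Arguments.
Unset Strict Implicit.
Unset Printing Implicit Defensive.

Import GRing.Theory.
Local Open Scope ring_scope.

(** Vector spaces with a given finite basis, and maps given by coefficients *)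

Notation free K B := {ffun B -> K^o}.

Section FreeMap.
Variables (K : fieldType) (A B : finType).

(* The map sending the basis vector [a] to [\sum_b M a b *: b]. *)
Definition coef_fun (M : A -> B -> K) (v : free K A) : free K B :=
  [ffun b => \sum_a v a * M a b].

Lemma coef_fun_linear M : linear (coef_fun M).
Proof.
move=> c u v; apply/ffunP=> b; rewrite !ffunE scaler_sumr -big_split /=.
by apply: eq_bigr => a _; rewrite !ffunE mulrDl -scalerAl.
Qed.

HB.instance Definition _ M :=
  GRing.isLinear.Build K (free K A) (free K B) *:%R (coef_fun M)
    (coef_fun_linear M).

Definition coef_map (M : A -> B -> K) : 'Hom(free K A, free K B) :=
  linfun (coef_fun M).

Lemma coef_mapE M v b : coef_map M v b = \sum_a v a * M a b.
Proof. by rewrite lfunE ffunE. Qed.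

End FreeMap.

(** Tensor products of divided powers of V = K^n *)

(* The monomial e_1^(c_1) ... e_n^(c_n) with c_1 + ... + c_n = k; these form
   the basis of D_k V. *)
Definition mono (n k : nat) :=
  {c : {ffun 'I_n -> 'I_k.+1} | (\sum_i c i == k)%N}.

Definition expo n k (c : mono n k) (i : 'I_n) : nat := val c i.

Notation Dbasis n a := {dffun forall i, mono n (a i)}.

(* D(a), the tensor product of the D_(a i) V over i in a finite set.  The
   tensor factors are labelled by i, so rearrangements are relabellings. *)
Notation D K n a := (free K (Dbasis n a)).

Definition multinomial (I : finType) (c : I -> nat) : nat :=
  ((\sum_i c i)`! %/ \prod_i (c i)`!)%N.

Section DividedPowers.
Variables (K : fieldType) (n : nat) (I J : finType).
Implicit Types (a : I -> nat) (b : J -> nat) (N : I * J -> nat).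

(* The tensor product over i of the comultiplications
   D_(a i) V -> \bigotimes_j D_(N (i, j)) V, where
   e^(c) |-> \sum_(c = \sum_j c_j) \bigotimes_j e^(c_j). *)
Definition comult a N : 'Hom(D K n a, D K n N) :=
  coef_map (fun (A : Dbasis n a) (C : Dbasis n N) =>
    [forall i, forall k, expo (A i) k == \sum_j expo (C (i, j)) k]%N%:R).

(* The tensor product over j of the multiplications
   \bigotimes_i D_(N (i, j)) V -> D_(b j) V, where
   e^(c) e^(c') = \prod_k 'C(c_k + c'_k, c_k) e^(c + c'). *)
Definition mult N b : 'Hom(D K n N, D K n b) :=
  coef_map (fun (C : Dbasis n N) (B : Dbasis n b) =>
    if [forall j, forall k, expo (B j) k == \sum_i expo (C (i, j)) k]%N
    then (\prod_j \prod_k multinomial (fun i => expo (C (i, j)) k))%N%:R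
    else 0).

End DividedPowers.

(** Compositions and partitions *)

(* [wt s] is the sequence s padded with zeros (or cut) to length m. *)
Definition wt (m : nat) (s : seq nat) (i : 'I_m) : nat := nth 0%N s i.

Definition Lambda (m r : nat) (a : 'I_m -> nat) : Prop := (\sum_i a i = r)%N.

Definition Lambda_plus (m r : nat) (a : 'I_m -> nat) : Prop :=
  Lambda r a /\ forall i j : 'I_m, (i <= j)%N -> (a j <= a i)%N.

(** Weyl modules *)

Section Weyl.
Variables (K : fieldType) (n m : nat) (mu : 'I_m -> nat).

(* The box in row i and column c is [Tagged _ (c : 'I_(mu i))]. *)
Definition box := {i : 'I_m & 'I_(mu i)}.
Definition brow (p : box) : 'I_m := tag p.
Definition bcol (p : box) : nat := tagged p.

Definition ncols : nat := \max_i mu i.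
Definition conj_part (c : nat) : nat := #|[set i : 'I_m | (c < mu i)%N]|.

(* The tensor power of V with one factor per box: its basis consists of the
   fillings of the boxes with elements of {1, ..., n}. *)
Notation filling := {ffun box -> 'I_n}.

(* The tensor product over the columns c of the exterior powers
   \Lambda^(mu'_c) V; its basis consists of the families of mu'_c-subsets. *)
Definition ext_basis :=
  {S : {ffun 'I_ncols -> {set 'I_n}} | [forall c, #|S c| == conj_part c]}.

Definition comult_boxes : 'Hom(D K n mu, free K filling) :=
  coef_map (fun (A : Dbasis n mu) (T : filling) =>
    [forall i, forall k,
       expo (A i) k == #|[set p | (brow p == i) && (T p == k)]|]%:R).

Definition column_inversions (T : filling) : nat :=
  #|[set pq : box * box | [&& bcol pq.1 == bcol pq.2,
      (brow pq.1 < brow pq.2)%N & (T pq.2 < T pq.1)%N]]|.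

(* Column c of T has mu'_c entries, so if they form a set of cardinality mu'_c
   then they are pairwise distinct. *)
Definition wedge_columns : 'Hom(free K filling, free K ext_basis) :=
  coef_map (fun (T : filling) (S : ext_basis) =>
    if [forall c, val S c == [set T p | p in [set p | bcol p == c]]]
    then (-1) ^+ column_inversions T else 0).

Definition dprime : 'Hom(D K n mu, free K ext_basis) :=
  (wedge_columns \o comult_boxes)%VF.

(* \Delta(mu) is [subvs_of (limg dprime)]; see the notation [Weyl] below. *)
Definition piWeyl : 'Hom(D K n mu, subvs_of (limg dprime)) :=
  linfun (vsproj (limg dprime) \o dprime).

End Weyl.

Notation Weyl K n mu := (subvs_of (limg (dprime K n mu))).

(** The map \square *)

Section Square.
Variables (K : fieldType) (n : nat) (lam : 'I_n -> nat).

(* The pairs (s, t) with 1 <= s <= n - 1 and 1 <= t <= lam_(s+1): an element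
   consists of the pair of indices (s, s+1) and of the predecessor of t. *)
Definition sq_index :=
  {p : {ij : 'I_n * 'I_n | ij.2 == ij.1.+1 :> nat} & 'I_(lam (val p).2)}.

Definition sq_s (x : sq_index) : 'I_n := (val (tag x)).1.
Definition sq_s1 (x : sq_index) : 'I_n := (val (tag x)).2.
Definition sq_t (x : sq_index) : nat := (tagged x).+1.

Definition sq_wt (x : sq_index) (i : 'I_n) : nat :=
  if i == sq_s x then (lam i + sq_t x)%N
  else if i == sq_s1 x then (lam i - sq_t x)%N
  else lam i.

Definition sq_mx (x : sq_index) (ij : 'I_n * 'I_n) : nat :=
  let: (i, j) := ij in
  if i == j then (if i == sq_s1 x then lam i - sq_t x else lam i)%N
  else if (i == sq_s x) && (j == sq_s1 x) then sq_t x
  else 0%N.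

(* The restriction of \square to D(lam(s,t)): the factor in position s is sent
   to positions s and s + 1 in degrees lam_s and t, the other factors stay
   (tensor factors D_0 V = K are inserted elsewhere). *)
Definition sq_component (x : sq_index) : 'Hom(D K n (sq_wt x), D K n lam) :=
  (mult K n (sq_mx x) lam \o comult K n (sq_wt x) (sq_mx x))%VF.

(* The direct sum of the D(lam(s,t)): its basis is the disjoint union of
   their bases. *)
Notation sq_source := (free K {x : sq_index & Dbasis n (sq_wt x)}).

Definition sq_proj (x : sq_index) (v : sq_source) : D K n (sq_wt x) :=
  [ffun A => v (Tagged (fun x => Dbasis n (sq_wt x)) A)].

Definition square_fun (v : sq_source) : D K n lam :=
  \sum_x sq_component x (sq_proj x v).

Lemma square_fun_linear : linear square_fun.
Proof.
move=> c u v; rewrite /square_fun scaler_sumr -big_split /=.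
apply: eq_bigr => x _; rewrite -linearP; congr (sq_component x _).
by apply/ffunP=> A; rewrite !ffunE.
Qed.

HB.instance Definition _ :=
  GRing.isLinear.Build K sq_source (D K n lam) *:%R square_fun
    square_fun_linear.

Definition square : 'Hom(sq_source, D K n lam) := linfun square_fun.

End Square.

(** Semistandard tableaux and the maps \phi_T *)

Section Tableaux.
Variables (K : fieldType) (n m : nat) (lam : 'I_n -> nat) (mu : 'I_m -> nat).

Definition tableau := {ffun box mu -> 'I_n}.

Definition semistandard (T : tableau) : bool :=
  [forall p, forall q,
     ((brow p == brow q) && (bcol p <= bcol q)%N ==> (T p <= T q)%N) &&
     ((bcol p == bcol q) && (brow p < brow q)%N ==> (T p < T q)%N)].

Definition has_weight (T : tableau) : bool :=
  [forall i, #|[set p | T p == i]| == lam i].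

Definition SST : {set tableau} := [set T | semistandard T && has_weight T].

Definition row_content (T : tableau) (ij : 'I_n * 'I_m) : nat :=
  #|[set p | (T p == ij.1) && (brow p == ij.2)]|.

Definition phi (T : tableau) : 'Hom(D K n lam, Weyl K n mu) :=
  (piWeyl K n mu \o mult K n (row_content T) mu
     \o comult K n lam (row_content T))%VF.

Definition psi : 'Hom(D K n lam, Weyl K n mu) := \sum_(T in SST) phi T.

End Tableaux.

(** Binary notions *)

Lemma l2_ex (y : nat) : exists i, (y < 2 ^ i)%N.
Proof. by exists y; apply: ltn_expl. Qed.

Definition l2 (y : nat) : nat := ex_minn (l2_ex y).

(* [two_complement i k]: k is a 2-complement of i. *)
Definition two_complement (i k : nat) : Prop :=
  if i == 0%N then is_true (odd k)
  else exists (m : nat) (d : nat -> bool) (M : nat) (t : nat -> bool),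
    [/\ d m, (i = \sum_(0 <= j < m.+1) d j * 2 ^ j)%N
      & (i + k = \sum_(m.+1 <= j < M) t j * 2 ^ j
                 + \sum_(0 <= j < m.+1) 2 ^ j)%N].

(* j0 is the maximum of the set of j in [0, B] of which k is a
   2-complement. *)
Definition max_two_complement (B k j0 : nat) : Prop :=
  [/\ (j0 <= B)%N, two_complement j0 k
    & forall j, (j <= B)%N -> two_complement j k -> (j <= j0)%N].

Definition infinite_field (K : fieldType) : Prop :=
  forall s : seq K, exists x, x \notin s.

(* Main.v *)
(* For vectors v_1, ..., v_n the elements v_1^(l_1) (x) ... (x) v_n^(l_n), with
   generic coordinates, generate D(lam); a linear map f on D(lam) is studied
   through its values f(v) on them.  In characteristic 2, d'_mu sends such
   products to sums of monomials indexed by fillings, without signs, which are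
   symmetric in the rows of a column and vanish when two boxes of a column carry
   the same vector.  Summing over the semistandard tableaux, psi(v) becomes a sum
   over all fillings of mu of weight lam without a 1 in the second row, and
   exchanging the two boxes of a column cancels all of them except those whose
   first b columns have a 1 on top.

   The map f kills the image of \square iff f(v) is unchanged when u v_s is added
   to v_(s+1), because the coefficient of u^t is f composed with \square on
   D(lam(s,t)).  For psi this coefficient is an explicit nonzero element times
   'C(a - b + t, t) if s = 1 (zero if t > d), b + 1 if s = 2 and 2 if s > 2, so the
   condition is a statement on the parity of binomial coefficients.

   If f is invariant under these shears then f kills the kernel of d'_lam.  For
   if A violates semistandardness in rows s, s+1 at the letter m, then expanding
   f(.., a + z, z + y, ..) = f(.., a + z, y - a, ..) with a supported on letters
   < m and y on letters > m, and taking a coefficient whose degree in z exceeds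
   lam_s, gives e_A plus terms B of larger statistic \sum i * k * B_ik in the
   kernels of both f and d'_lam.  On the other hand the coefficient of d'_lam(e_B)
   at the column sets of a semistandard tableau A vanishes unless B = A or B has
   smaller statistic. *)

Require Import Defs.
From mathcomp Require Import all_boot all_fingroup all_algebra zify mpoly.
Import Defs.

Set Implicit Arguments.
Unset Strict Implicit.
Unset Printing Implicit Defensive.

Import GRing.Theory.
Local Open Scope ring_scope.


(** * Multinomial coefficients count functions *)

Section FiberCount.
Local Open Scope nat_scope.
Variables (X Y I : finType) (kappa : X -> Y).

(** The value [None] marks the elements outside [D], so that the domain can shrink by one element at
    a time in an induction. *)
Definition partial_fibers (D : {set X}) (C : Y -> I -> nat) :=
  [set tau : {ffun X -> option I} |
    [forall p, (tau p != None) == (p \in D)] &&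
    [forall y, forall i,
       #|[set p | (kappa p == y) && (tau p == Some i)]| == C y i]].

Lemma partial_fibersP (D : {set X}) (C : Y -> I -> nat)
    (tau : {ffun X -> option I}) :
  reflect ((forall p, (tau p != None) = (p \in D)) /\
           (forall y i, #|[set p | (kappa p == y) && (tau p == Some i)]| = C y i))
          (tau \in partial_fibers D C).
Proof.
rewrite inE; apply: (iffP andP) => [[/forallP h1 /forallP h2]|[h1 h2]]; split.
- by move=> p; move: (h1 p) => /eqP.
- by move=> y i; move/forallP: (h2 y) => /(_ i)/eqP.
- by apply/forallP => p; apply/eqP; apply: h1.
- by apply/forallP => y; apply/forallP => i; apply/eqP; apply: h2.
Qed.

(** Erasing the value at [x] is injective on the functions with label [i] there, and restoring the
    label inverts it. *)
Lemma card_partial_fibers_at (D : {set X}) (C : Y -> I -> nat) x i :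
  x \in D -> 0 < C (kappa x) i ->
  #|[set tau in partial_fibers D C | tau x == Some i]| =
  #|partial_fibers (D :\ x)
      (fun y j => C y j - ((y == kappa x) && (j == i)))|.
Proof.
move=> xD Cpos.
pose put (o : option I) (tau : {ffun X -> option I}) : {ffun X -> option I} :=
  [ffun p => if p == x then o else tau p].
have cnt (tau : {ffun X -> option I}) y j : tau x = Some i ->
    #|[set p | (kappa p == y) && (tau p == Some j)]| =
    #|[set p | (kappa p == y) && (put None tau p == Some j)]|
      + ((y == kappa x) && (j == i)).
  move=> tx; rewrite (cardsD1 x) addnC; congr (_ + _).
    apply: eq_card => p; rewrite !inE ffunE.
    by case: (p == x); rewrite //= andbF.
  by rewrite !inE tx (eq_sym y) (eq_sym j); congr (nat_of_bool (_ && _)).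
rewrite -(@card_in_imset _ _ (put None)); last first.
  move=> t1 t2; rewrite !inE => /andP[_ /eqP h1] /andP[_ /eqP h2] /ffunP e.
  apply/ffunP => p; case: (eqVneq p x) => [->|pn]; first by rewrite h1 h2.
  by move: (e p); rewrite !ffunE (negbTE pn).
apply: eq_card => tau; apply/imsetP/idP => [[t0]|tauP].
  rewrite inE => /andP[/partial_fibersP[h1 h2] /eqP tx] ->.
  apply/partial_fibersP; split=> [p|y j].
    by rewrite !inE ffunE -h1; case: (p == x).
  by rewrite -(h2 y j) (cnt t0) // addnK.
case/partial_fibersP: tauP => h1 h2.
have tx : tau x = None.
  by apply/eqP; move: (h1 x); rewrite !inE eqxx /= => /negbFE.
have K : put None (put (Some i) tau) = tau.
  by apply/ffunP => p; rewrite !ffunE; case: (eqVneq p x) => // ->.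
exists (put (Some i) tau) => //; rewrite inE.
have px : put (Some i) tau x = Some i by rewrite ffunE eqxx.
rewrite px eqxx andbT; apply/partial_fibersP; split=> [p|y j].
  rewrite ffunE; case: (eqVneq p x) => [->|pn]; first by rewrite xD.
  by rewrite h1 !inE pn.
rewrite (cnt _ y j px) K h2 subnK //.
by case: eqVneq => [->|//]; case: eqVneq => [->|].
Qed.

(** Induction on [D], splitting by the label [i] of a chosen [x]. Removing [x] takes the factor
    [C (kappa x) i] out of a factorial; these factors add up to the size of the fiber of [x], which
    is the factor lost on the right. *)
Lemma card_partial_fibers (D : {set X}) (C : Y -> I -> nat) :
  (forall y, \sum_i C y i = #|[set p in D | kappa p == y]|) ->
  #|partial_fibers D C| * \prod_y \prod_i (C y i)`! =
  \prod_y #|[set p in D | kappa p == y]|`!.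
Proof.
move: {2}#|D| (leqnn #|D|) => N; elim: N D C => [|N IH] D C leN CD.
  have D0 : D = set0 by apply/eqP; rewrite -cards_eq0 -leqn0.
  have C0 y i : C y i = 0.
    apply/eqP; move/eqP: (CD y).
    have -> : [set p in D | kappa p == y] = set0.
      by apply/setP => p; rewrite !inE D0 inE.
    by rewrite cards0 sum_nat_eq0 => /forallP/(_ i)/implyP->.
  rewrite [X in _ * X]big1 ?[RHS]big1.
  - rewrite muln1; apply/eqP/cards1P; exists [ffun=> None].
    apply/setP => t; rewrite [RHS]inE; apply/partial_fibersP/eqP => [[h _]|->].
      by apply/ffunP => p; rewrite ffunE; apply/eqP/negbNE; rewrite h D0 inE.
    split=> [p|y i]; first by rewrite ffunE D0 inE.
    rewrite C0; apply/eqP; rewrite cards_eq0; apply/eqP/setP => p.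
    by rewrite !inE ffunE andbF.
  - move=> y _; have -> : [set p in D | kappa p == y] = set0.
      by apply/setP => p; rewrite !inE D0 inE.
    by rewrite cards0.
  - by move=> y _; rewrite big1 // => i _; rewrite C0.
case: (set_0Vmem D) => [D0|[x xD]].
  by apply: IH => //; rewrite D0 cards0.
have cardD' : #|D :\ x| <= N.
  by move: leN; rewrite (cardsD1 x D) xD add1n ltnS.
set y0 := kappa x.
have cD y : #|[set p in D | kappa p == y]| =
    #|[set p in D :\ x | kappa p == y]| + (y == y0).
  rewrite (cardsD1 x) addnC; congr (_ + _).
    by apply: eq_card => p; rewrite !inE andbA.
  by rewrite inE xD /= eq_sym.
have split_i : #|partial_fibers D C| =
    \sum_i #|[set tau in partial_fibers D C | tau x == Some i]|.
  rewrite -sum1_card (partition_big (fun tau : {ffun X -> option I} => tau x) predT) //=.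
  rewrite (bigID (fun o => o == None)) /= [X in X + _]big1 ?add0n; last first.
    move=> o /eqP ->; rewrite big1 // => tau /andP[/partial_fibersP[h _] /eqP tx].
    by move: (h x); rewrite tx xD.
  rewrite (reindex_omap (@Some I) id) /=; last by case.
  apply: eq_big => [i|i _]; first by rewrite eqxx.
  by rewrite -sum1_card; apply: eq_bigl => tau; rewrite !inE.
rewrite split_i big_distrl /=.
transitivity (\sum_i C y0 i * \prod_y #|[set p in D :\ x | kappa p == y]|`!).
  apply: eq_bigr => i _; case: (posnP (C y0 i)) => [C0|Cpos].
    rewrite C0 mul0n; apply/eqP; rewrite muln_eq0; apply/orP; left.
    rewrite cards_eq0; apply/eqP/setP => tau; rewrite [RHS]inE.
    apply/negbTE/negP; rewrite inE => /andP[/partial_fibersP[_ h] tx].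
    by move: (h y0 i) => /eqP; rewrite C0 cards_eq0 => /eqP/setP/(_ x); rewrite !inE eqxx tx.
  rewrite card_partial_fibers_at //.
  set C' := fun y j => _.
  have C'D y : \sum_j C' y j = #|[set p in D :\ x | kappa p == y]|.
    apply/eqP; rewrite -(eqn_add2r (y == y0)) -cD -CD /C'.
    have -> : nat_of_bool (y == y0) = \sum_j ((y == y0) && (j == i) : nat).
      rewrite (bigD1 i) //= eqxx andbT big1 ?addn0 // => j /negbTE->.
      by rewrite andbF.
    rewrite -big_split /=; apply/eqP/eq_bigr => j _; rewrite subnK //.
    by case: eqVneq => [->|//]; case: eqVneq => [->|].
  rewrite -(IH _ C' cardD' C'D) mulnCA; congr (_ * _).
  rewrite !(bigD1 y0 isT) /= mulnA; congr (_ * _).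
    rewrite !(bigD1 i isT) /= mulnA; congr (_ * _).
      rewrite /C' !eqxx /= subn1; by case: (C y0 i) Cpos.
    by apply: eq_bigr => j /negbTE jn; rewrite /C' jn andbF subn0.
  apply: eq_bigr => y /negbTE yn; apply: eq_bigr => j _.
  by rewrite /C' yn subn0.
rewrite -big_distrl /= CD !(bigD1 y0 isT) /= mulnA; congr (_ * _).
  by rewrite cD eqxx addn1 factS.
by apply: eq_bigr => y /negbTE yn; rewrite cD yn addn0.
Qed.

Lemma card_fibers (C : Y -> I -> nat) :
  (forall y, \sum_i C y i = #|[set p | kappa p == y]|) ->
  #|[set tau : {ffun X -> I} | [forall y, forall i,
       #|[set p | (kappa p == y) && (tau p == i)]| == C y i]]|
    * \prod_y \prod_i (C y i)`! = \prod_y (\sum_i C y i)`!.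
Proof.
move=> CD.
have CT y : \sum_i C y i = #|[set p in [set: X] | kappa p == y]|.
  by rewrite CD; apply: eq_card => p; rewrite !inE.
under [RHS]eq_bigr do rewrite CT.
rewrite -(card_partial_fibers CT); congr (_ * _).
pose some (tau : {ffun X -> I}) := [ffun p => Some (tau p)].
rewrite -(@card_imset _ _ some) => [|t1 t2 /ffunP e]; last first.
  by apply/ffunP => p; move: (e p); rewrite !ffunE => -[].
apply: eq_card => t; apply/imsetP/idP => [[tau] + ->|/partial_fibersP[h1 h2]].
  rewrite inE => /forallP h; apply/partial_fibersP; split=> [p|y i].
    by rewrite ffunE inE.
  move/forallP: (h y) => /(_ i)/eqP <-; apply: eq_card => p.
  by rewrite !inE ffunE.
case: (pickP (fun p => t p == None)) => [p /eqP tp|tS].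
  by move: (h1 p); rewrite tp inE.
(* Stripping [Some] needs a default label; if there are no labels then [X] is empty as well. *)
case: (pickP (@predT I)) => [i0 _|I0]; last first.
  have X0 (p : X) : False.
    by move: (tS p); case: (t p) => // i; move: (I0 i).
  exists [ffun p => match X0 p with end]; last by apply/ffunP => p; case: (X0 p).
  rewrite inE; apply/forallP => y; apply/forallP => i; by move: (I0 i).
have tE p : t p = Some (odflt i0 (t p)) by move: (tS p); case: (t p).
exists [ffun p => odflt i0 (t p)]; last first.
  by apply/ffunP => p; rewrite !ffunE -tE.
rewrite inE; apply/forallP => y; apply/forallP => i; rewrite -h2; apply/eqP.
by apply: eq_card => p; rewrite !inE ffunE [in RHS]tE.
Qed.

End FiberCount.

Lemma dvdn_prod_fact (I : finType) (c : I -> nat) :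
  (\prod_i (c i)`! %| (\sum_i c i)`!)%N.
Proof.
have := @card_fibers 'I_(\sum_i c i) unit I (fun=> tt) (fun=> c).
rewrite !(big_pred1 tt) => [H||]; try by case.
rewrite -H ?dvdn_mull // => y.
rewrite -{1}(card_ord (\sum_i c i)%N) -cardsT; apply: eq_card => p.
by rewrite !inE; case: y.
Qed.

(** The structure constants of the multiplication of divided powers are thus numbers of labellings,
    which turns [mult] into a sum over labellings of boxes. *)
Lemma card_fibers_multinomial (X Y I : finType) (kappa : X -> Y)
    (C : Y -> I -> nat) :
  (forall y, \sum_i C y i = #|[set p | kappa p == y]|)%N ->
  #|[set tau : {ffun X -> I} | [forall y, forall i,
       #|[set p | (kappa p == y) && (tau p == i)]| == C y i]]|
    = (\prod_y multinomial (C y))%N.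
Proof.
move=> CD; apply/eqP.
have P0 : (0 < \prod_y \prod_i (C y i)`!)%N.
  by apply: prodn_gt0 => y; apply: prodn_gt0 => i; apply: fact_gt0.
rewrite -(eqn_pmul2r P0) card_fibers // -big_split /=.
by apply/eqP/eq_bigr => y _; rewrite divnK // dvdn_prod_fact.
Qed.

(** * Extension of scalars and generic elements of tensor products of divided powers *)

Section Extension.
Variables (K : fieldType) (R : comNzRingType) (io : {rmorphism K -> R}).

Definition delta (A : finType) (a : A) : free K A := [ffun a' => (a' == a)%:R].

Lemma free_delta (A : finType) (v : free K A) : v = \sum_a v a *: delta a.
Proof.
apply/ffunP => a; rewrite sum_ffunE (bigD1 a) //= !ffunE eqxx /GRing.scale /= mulr1.
rewrite big1 ?addr0 // => a' ne; rewrite !ffunE eq_sym (negbTE ne).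
by rewrite /GRing.scale /= mulr0.
Qed.

(* The R-linear extension of f along io, in coordinates. *)
Definition ext (A B : finType) (f : 'Hom(free K A, free K B))
    (x : A -> R) (b : B) : R := \sum_a x a * io (f (delta a) b).

Lemma ext_coef_map (A B : finType) (M : A -> B -> K) x b :
  ext (coef_map M) x b = \sum_a x a * io (M a b).
Proof.
apply: eq_bigr => a _; rewrite coef_mapE (bigD1 a) //= ffunE eqxx mul1r.
by rewrite big1 ?addr0 // => a' ne; rewrite ffunE (negbTE ne) mul0r.
Qed.

Lemma eq_ext (A B : finType) (f : 'Hom(free K A, free K B)) x y :
  x =1 y -> ext f x =1 ext f y.
Proof. by move=> xy b; apply: eq_bigr => a _; rewrite xy. Qed.

Lemma ext_comp (A B C : finType) (g : 'Hom(free K B, free K C))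
    (f : 'Hom(free K A, free K B)) x c :
  ext (g \o f)%VF x c = ext g (ext f x) c.
Proof.
rewrite /ext; under [RHS]eq_bigr do rewrite big_distrl /=.
rewrite exchange_big /=; apply: eq_bigr => a _; rewrite comp_lfunE.
rewrite {1}(free_delta (f (delta a))) linear_sum sum_ffunE rmorph_sum big_distrr /=.
by apply: eq_bigr => b _; rewrite linearZ ffunE /= rmorphM /= mulrA.
Qed.

Lemma ext_sum (A B I : finType) (P : pred I) (f : I -> 'Hom(free K A, free K B)) x b :
  ext (\sum_(i | P i) f i) x b = \sum_(i | P i) ext (f i) x b.
Proof.
rewrite /ext exchange_big /=; apply: eq_bigr => a _.
by rewrite sum_lfunE sum_ffunE rmorph_sum big_distrr.
Qed.

Lemma extD (A B : finType) (f : 'Hom(free K A, free K B)) x y b :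
  ext f (fun a => x a + y a) b = ext f x b + ext f y b.
Proof. by rewrite /ext -big_split; apply: eq_bigr => a _; rewrite mulrDl. Qed.

Lemma ext_sumr (A B I : finType) (P : pred I) (f : 'Hom(free K A, free K B))
    (c : I -> R) x b :
  ext f (fun a => \sum_(i | P i) c i * x i a) b =
  \sum_(i | P i) c i * ext f (x i) b.
Proof.
rewrite /ext; under eq_bigr do rewrite big_distrl /=.
rewrite exchange_big; apply: eq_bigr => i _; rewrite big_distrr.
by apply: eq_bigr => a _; rewrite /= mulrA.
Qed.

End Extension.

(** * Monomial bases of divided powers *)

Section Monomials.
Variables (n : nat) (I : finType).

Fact mkmono_subproof (k : nat) (c : 'I_n -> nat) :
  (\sum_i c i = k)%N ->
  (\sum_i [ffun i => inord (c i) : 'I_k.+1] i == k)%N.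
Proof.
move=> ck; rewrite -[X in _ == X]ck; apply/eqP/eq_bigr => i _; rewrite ffunE inordK //.
by rewrite ltnS -ck (bigD1 i) //= leq_addr.
Qed.

Definition mkmono k (c : 'I_n -> nat) (ck : (\sum_i c i = k)%N) : mono n k :=
  exist (fun c : {ffun 'I_n -> 'I_k.+1} => \sum_i c i == k)%N _
    (mkmono_subproof ck).

Lemma expo_mkmono k (c : 'I_n -> nat) (ck : (\sum_i c i = k)%N) i :
  expo (mkmono ck) i = c i.
Proof.
rewrite /expo /= ffunE inordK // ltnS -ck (bigD1 i) //=; exact: leq_addr.
Qed.

Definition mkD (a : I -> nat) (c : I -> 'I_n -> nat)
    (ca : forall i, (\sum_k c i k = a i)%N) : Dbasis n a :=
  [ffun i => mkmono (ca i)].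

Lemma expo_mkD (a : I -> nat) (c : I -> 'I_n -> nat)
    (ca : forall i, (\sum_k c i k = a i)%N) i k : expo (mkD ca i) k = c i k.
Proof. by rewrite ffunE expo_mkmono. Qed.

Lemma Dbasis_inj (a : I -> nat) (A B : Dbasis n a) :
  (forall i k, expo (A i) k = expo (B i) k) -> A = B.
Proof.
move=> e; apply/ffunP => i; apply/val_inj/ffunP => k; apply/val_inj; exact: e.
Qed.

Lemma sum_expo (a : I -> nat) (A : Dbasis n a) i : (\sum_k expo (A i) k = a i)%N.
Proof. exact/eqP/(valP (A i)). Qed.

End Monomials.

Section Generic.
Variables (K : fieldType) (R : comNzRingType) (io : {rmorphism K -> R}) (n : nat).

(* The coordinates of the tensor product over i of the divided powers
   (v i)^(N i). *)
Definition dpow (I : finType) (N : I -> nat) (v : I -> 'I_n -> R)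
    (C : Dbasis n N) : R := \prod_i \prod_k v i k ^+ expo (C i) k.

(** Divided powers of a vector are comultiplied into tensor products of divided powers of the same
    vector. Only the monomial whose exponents are the sums over [j] of those of [C] contributes to
    the coordinate at [C]. *)
Lemma ext_comult (I J : finType) (a : I -> nat) (N : I * J -> nat) v :
  (forall i, \sum_j N (i, j) = a i)%N ->
  ext io (comult K n a N) (@dpow _ a v) =1 @dpow _ N (fun ij => v ij.1).
Proof.
move=> Na C; rewrite ext_coef_map.
have ca i : (\sum_k \sum_j expo (C (i, j)) k = a i)%N.
  by rewrite exchange_big /= -Na; apply: eq_bigr => j _; rewrite sum_expo.
rewrite (bigD1 (mkD ca)) //= big1 ?addr0 => [|A ne].
  have -> : [forall i, forall k, expo (mkD ca i) k == \sum_j expo (C (i, j)) k]%N.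
    by apply/forallP => i; apply/forallP => k; rewrite expo_mkD.
  rewrite rmorph1 mulr1 /dpow.
  rewrite (eq_bigr (fun i => \prod_j \prod_k v i k ^+ expo (C (i, j)) k)); last first.
    move=> i _; rewrite exchange_big /=; apply: eq_bigr => k _.
    by rewrite expo_mkD expr_sum.
  by rewrite pair_bigA; apply: eq_bigr => -[].
case: forallP => h; last by rewrite rmorph0 mulr0.
case/eqP: ne; apply: Dbasis_inj => i k; rewrite expo_mkD.
by move/forallP: (h i) => /(_ k)/eqP.
Qed.

(** * Coordinates indexed by fillings of boxes *)

Section Boxes.
Variables (m : nat) (b : 'I_m -> nat).
Notation box := (box b).
Notation filling := {ffun box -> 'I_n}.

Fact contentD_subproof (T : filling) i :
  (\sum_k #|[set p | (brow p == i) && (T p == k)]| = b i)%N.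
Proof.
rewrite (eq_bigr (fun k => \sum_(p : box | (brow p == i) && (T p == k)) 1)%N);
  last by move=> k _; rewrite sum1dep_card.
rewrite -(partition_big T predT) //= sum1dep_card -[RHS]card_ord.
rewrite -(@card_imset _ _ (Tagged (fun i => 'I_(b i)))); last exact: eq_from_Tagged.
apply: eq_card => p; rewrite inE; apply/eqP/imsetP => [<-|[c _ ->]] //.
by exists (tagged p) => //; case: p.
Qed.

Definition contentD (T : filling) : Dbasis n b := mkD (contentD_subproof T).

Lemma expo_contentD T i k :
  expo (contentD T i) k = #|[set p | (brow p == i) && (T p == k)]|.
Proof. exact: expo_mkD. Qed.

Lemma ext_comult_boxes (x : Dbasis n b -> R) (T : filling) :
  ext io (comult_boxes K n b) x T = x (contentD T).
Proof.
rewrite ext_coef_map (bigD1 (contentD T)) //= big1 ?addr0 => [|A ne].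
  have -> : [forall i, forall k, expo (contentD T i) k
               == #|[set p | (brow p == i) && (T p == k)]|].
    by apply/forallP => i; apply/forallP => k; rewrite expo_contentD.
  by rewrite rmorph1 mulr1.
case: forallP => h; last by rewrite rmorph0 mulr0.
case/eqP: ne; apply: Dbasis_inj => i k; rewrite expo_contentD.
by move/forallP: (h i) => /(_ k)/eqP.
Qed.

Lemma prod_boxes (v : 'I_m -> 'I_n -> R) (T : filling) :
  \prod_p v (brow p) (T p) = dpow v (contentD T).
Proof.
rewrite /dpow (partition_big (@brow m b) predT) //=; apply: eq_bigr => i _.
rewrite (partition_big T predT) //=; apply: eq_bigr => k _.
rewrite expo_contentD -prodr_const; apply: eq_big => [p|p]; first by rewrite inE.
by case/andP => /eqP -> /eqP ->.
Qed.

(** A labelling [tau] of the boxes, together with the letters [T], determines a monomial [C] of the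
    source. All labellings with the same [C] contribute [dpow w C], and their number is the product
    of multinomial coefficients in [mult]. *)
Lemma ext_mult (I : finType) (N : I * 'I_m -> nat) (w : I * 'I_m -> 'I_n -> R)
    (T : filling) :
  ext io (mult K n N b) (dpow w) (contentD T) =
  \sum_(tau : {ffun box -> I} |
          [forall ij, #|[set p | (tau p == ij.1) && (brow p == ij.2)]| == N ij])
     \prod_p w (tau p, brow p) (T p).
Proof.
rewrite ext_coef_map.
pose joint (tau : {ffun box -> I}) (C : Dbasis n N) :=
  [forall jk : 'I_m * 'I_n, forall i,
     #|[set p | ((brow p, T p) == jk) && (tau p == i)]|
       == expo (C (i, jk.1)) jk.2].
have jointP tau C : joint tau C ->
    \prod_p w (tau p, brow p) (T p) = dpow w C.
  move=> /forallP h; rewrite /dpow (partition_big (fun p => (tau p, brow p)) predT) //=.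
  apply: eq_bigr => -[i j] _.
  rewrite (partition_big T predT) //=; apply: eq_bigr => k _.
  move/forallP: (h (j, k)) => /(_ i)/eqP /= <-; rewrite -prodr_const.
  apply: eq_big => [p|p]; first by rewrite inE !xpair_eqE; do !case: (_ == _).
  by case/andP => /eqP[-> ->] /eqP ->.
rewrite [RHS](eq_bigr (fun tau : {ffun box -> I} =>
   \sum_(C | joint tau C) \prod_p w (tau p, brow p) (T p))); last first.
  move=> tau /forallP h.
  have NC ij : (\sum_k #|[set p | ((brow p, T p) == (ij.2, k)) && (tau p == ij.1)]| = N ij)%N.
    rewrite -(eqP (h ij)) -[RHS]sum1dep_card (partition_big T predT) //=.
    apply: eq_bigr => k _; rewrite -sum1dep_card; apply: eq_bigl => p.
    by rewrite /= ?xpair_eqE; do !case: (_ == _).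
  rewrite (big_pred1 (mkD NC)) // => C; apply/forallP/eqP => [hC|->].
    apply: Dbasis_inj => -[i j] k; rewrite expo_mkD /=.
    by move/forallP: (hC (j, k)) => /(_ i)/eqP.
  by case=> j k; apply/forallP => i; rewrite expo_mkD.
rewrite [RHS](exchange_big_dep predT) //=; apply: eq_bigr => C _.
transitivity (\sum_(tau | joint tau C) dpow w C); last first.
  rewrite [RHS](eq_bigl (joint^~ C)); last first.
    move=> tau; apply: andb_idl => /forallP h; apply/forallP => -[i j] /=.
    apply/eqP; rewrite -(sum_expo C) -sum1dep_card (partition_big T predT) //=.
    apply: eq_bigr => k _; move/forallP: (h (j, k)) => /(_ i)/eqP/= <-.
    rewrite -sum1dep_card; apply: eq_bigl => p.
    by rewrite /= ?xpair_eqE; do !case: (_ == _).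
  by apply: eq_bigr => tau /jointP.
rewrite sumr_const -[RHS]mulr_natr; congr (_ * _).
have -> : [forall j, forall k,
    expo (contentD T j) k == \sum_i expo (C (i, j)) k]%N =
  [forall jk : 'I_m * 'I_n, (\sum_i expo (C (i, jk.1)) jk.2 ==
      #|[set p | (brow p, T p) == jk]|)]%N.
  apply/forallP/forallP => [h [j k]|h j].
    by move/forallP: (h j) => /(_ k) /=; rewrite expo_contentD eq_sym.
  by apply/forallP => k; move: (h (j, k)); rewrite expo_contentD eq_sym.
case: forallP => [h|h].
  have := @card_fibers_multinomial _ _ I (fun p => (brow p, T p))
    (fun jk i => expo (C (i, jk.1)) jk.2) (fun jk => eqP (h jk)).
  rewrite cardsE => ->; rewrite rmorph_nat; congr (_%:R).
  by rewrite pair_bigA.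
rewrite rmorph0 eq_card0 // => tau; apply/negbTE/negP => /forallP hj.
apply: h => jk; apply/eqP; rewrite -sum1dep_card (partition_big tau predT) //=.
apply: eq_bigr => i _; move/forallP: (hj jk) => /(_ i)/eqP <-.
by rewrite -sum1dep_card.
Qed.

End Boxes.
End Generic.

(** * Products of column forms in characteristic 2 *)

Section Involution.
Variables (R : comNzRingType) (char2 : 2%N \in [pchar R]).

(** In characteristic 2, [x] and [g x] cancel. Comparing ranks in the enumeration picks one element
    of each pair. *)
Lemma sum_involution (X : finType) (P : pred X) (g : X -> X) (F : X -> R) :
  involutive g -> (forall x, P x -> P (g x)) -> (forall x, F (g x) = F x) ->
  (forall x, P x -> g x = x -> F x = 0) -> \sum_(x | P x) F x = 0.
Proof.
move=> gK Pg Fg F0.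
rewrite (bigID (fun x => g x == x)) /= big1 ?add0r => [|x /andP[Px /eqP]]; last exact: F0.
rewrite (bigID (fun x => enum_rank x < enum_rank (g x))%N) /=.
rewrite [X in _ + X](reindex_inj (inv_inj gK)) /=.
rewrite [X in _ + X](eq_bigl (fun x => (P x && (g x != x)) && (enum_rank x < enum_rank (g x))%N)).
  by under [X in _ + X]eq_bigr do rewrite Fg; rewrite addrr_pchar2.
move=> x; rewrite gK.
have -> : P (g x) = P x by apply/idP/idP => /Pg //; rewrite gK.
rewrite [x == _]eq_sym -leqNgt leq_eqVlt; case: (P x) => //=.
case: (altP eqP) => //= ne.
by case: eqP => //= /val_inj/enum_rank_inj e; case/eqP: ne.
Qed.
End Involution.

Section Columns.
Variables (K : fieldType) (R : comNzRingType) (io : {rmorphism K -> R}).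
Variables (charR : 2%N \in [pchar R]) (charK : 2%N \in [pchar K]).
Variables (n m : nat) (b : 'I_m -> nat).
Notation box := (box b).
Notation filling := {ffun box -> 'I_n}.
Implicit Types (S : ext_basis n b) (T : filling) (y : box -> 'I_n -> R).

Definition has_columns S T :=
  [forall c, val S c == [set T p | p in [set p | bcol p == c :> nat]]].

Lemma bcol_ltn (p : box) : (bcol p < ncols b)%N.
Proof.
by apply: leq_trans (leq_bigmax (brow p)); rewrite /bcol; case: p => i [c].
Qed.

Lemma box_inj (p q : box) : brow p = brow q -> bcol p = bcol q -> p = q.
Proof.
case: p q => [i c] [j d]; rewrite /brow /bcol /= => ij; subst j => cd.
by congr existT; apply: val_inj.
Qed.

Definition mkbox (i : 'I_m) (c : nat) (h : (c < b i)%N) : box :=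
  Tagged (fun i => 'I_(b i)) (Ordinal h).

Lemma card_column c : #|[set p : box | bcol p == c]| = conj_part b c.
Proof.
rewrite /conj_part -(card_in_imset (f := @brow m b)); last first.
  by move=> p q; rewrite !inE => /eqP <- /eqP e f; apply: box_inj.
apply: eq_card => i; rewrite inE; apply/imsetP/idP => [[p]|h].
  by rewrite inE => /eqP <- ->; rewrite /bcol; case: p => j [].
by exists (mkbox h) => //; rewrite inE /bcol /=.
Qed.

(** A column set in [S] has as many elements as its column has boxes, so [T] is injective on
    columns. *)
Lemma has_columns_inj S T (p q : box) :
  has_columns S T -> bcol p = bcol q -> T p = T q -> p = q.
Proof.
move=> /forallP h pq Tpq.
have /imset_injP : #|[set T p' | p' in [set p' | bcol p' == bcol p]]| ==
    #|[set p' : box | bcol p' == bcol p]|.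
  move: (h (Ordinal (bcol_ltn p))) => /eqP /= <-.
  by move/forallP: (valP S) => /(_ (Ordinal (bcol_ltn p)))/eqP ->; rewrite card_column.
by apply => //; rewrite inE // pq.
Qed.

Lemma has_columns_tperm S T (p q : box) :
  bcol p = bcol q -> has_columns S [ffun x => T (tperm p q x)] = has_columns S T.
Proof.
move=> pq; apply: eq_forallb => c; congr (_ == _).
apply/setP => k; apply/imsetP/imsetP => -[x]; rewrite inE => xc ->.
  exists (tperm p q x); last by rewrite ffunE.
  by rewrite inE; case: tpermP xc => // ->; rewrite pq.
exists (tperm p q x); last by rewrite ffunE tpermK.
by rewrite inE; case: tpermP xc => // ->; rewrite pq.
Qed.

(** The coordinate at [S] of the tensor product over the columns of the wedge products of the
    vectors [y p]: a product of permanents, which in characteristic 2 are minors. *)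
Definition colform S y : R := \sum_(T : filling | has_columns S T) \prod_p y p (T p).

Lemma eq_colform S y1 y2 : (forall p k, y1 p k = y2 p k) -> colform S y1 = colform S y2.
Proof. by move=> e; apply: eq_bigr => T _; apply: eq_bigr => p _. Qed.

Lemma colform_tperm S y (p q : box) : bcol p = bcol q ->
  colform S (fun x => y (tperm p q x)) = colform S y.
Proof.
move=> pq; rewrite /colform.
rewrite (reindex_inj (h := fun T : filling => [ffun x => T (tperm p q x)])) /=.
  apply: eq_big => [T|T _]; first by rewrite has_columns_tperm.
  rewrite [RHS](reindex_inj (@perm_inj _ (tperm p q))) /=.
  by apply: eq_bigr => x _; rewrite ffunE.
move=> T1 T2 /ffunP e; apply/ffunP => x.
by move: (e (tperm p q x)); rewrite !ffunE tpermK.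
Qed.

(** Exchanging the entries of [p] and [q] is an involution preserving the summands, without fixed
    points since the entries of a column are distinct. *)
Lemma colform_eq0 S y (p q : box) : p != q -> bcol p = bcol q ->
  (forall k, y p k = y q k) -> colform S y = 0.
Proof.
move=> npq pq ypq.
apply: (sum_involution charR (g := fun T : filling => [ffun x => T (tperm p q x)])).
- by move=> T; apply/ffunP => x; rewrite !ffunE tpermK.
- by move=> T; rewrite has_columns_tperm.
- move=> T; rewrite [RHS](reindex_inj (@perm_inj _ (tperm p q))) /=.
  by apply: eq_bigr => x _; rewrite ffunE; case: tpermP => // ->; rewrite ypq.
- move=> T hT /ffunP/(_ p); rewrite ffunE tpermL => e.
  by case/eqP: npq; rewrite (has_columns_inj hT pq).
Qed.

(** By linearity in the vector at [q], the additional term has the same vector at [p] and at [q]. *)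
Lemma colform_add S y y' u (p q : box) : p != q -> bcol p = bcol q ->
  (forall k, y' q k = y q k + u * y p k) ->
  (forall x k, x != q -> y' x k = y x k) -> colform S y' = colform S y.
Proof.
move=> npq pq yq yne.
pose z x := if x == q then y p else y x.
transitivity (colform S y + u * colform S z).
  rewrite /colform big_distrr -big_split /=; apply: eq_bigr => T _.
  rewrite !(bigD1 q isT) /= yq mulrDl /z eqxx -mulrA; congr (_ * _ + u * (_ * _)).
    by apply: eq_bigr => x ne; rewrite yne.
  by apply: eq_bigr => x ne; rewrite yne // (negbTE ne).
rewrite (@colform_eq0 S z p q) // ?mulr0 ?addr0 // => k.
by rewrite /z eqxx (negbTE npq).
Qed.

(** The boxes of [Q] are changed one at a time. The vector at [g q] remains that of [y] because
    [g q] lies outside [Q]. *)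
Lemma colform_shear S y y' (Q : {set box}) (g : box -> box) (u : box -> R) :
  (forall q, q \in Q -> bcol (g q) = bcol q /\ g q \notin Q) ->
  (forall q k, q \in Q -> y' q k = y q k + u q * y (g q) k) ->
  (forall q k, q \notin Q -> y' q k = y q k) -> colform S y' = colform S y.
Proof.
move=> gQ yQ yn.
(* [z s] is [y] changed at the boxes of [Q] that occur in [s]. *)
pose z (s : seq box) x k := y x k + (if (x \in Q) && (x \in s) then u x * y (g x) k else 0).
transitivity (colform S (z (enum {: box}))).
  apply: eq_colform => p k; rewrite /z mem_enum andbT; case: ifP => pQ; first by rewrite yQ.
  by rewrite addr0 yn ?pQ.
elim: (enum {: box}) => [|x s <-].
  by apply: eq_colform => p k; rewrite /z in_nil andbF addr0.
case: (boolP ((x \in Q) && (x \notin s))) => [/andP[xQ xs]|h]; last first.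
  apply: eq_colform => p k; rewrite /z in_cons.
  by case: eqVneq h => //= ->; case: (x \in Q) => //=; rewrite negbK => ->.
have [gx gxQ] := gQ _ xQ.
apply: (@colform_add S (z s) _ (u x) (g x) x) => //.
- by apply: contraNneq gxQ => ->.
- move=> k; rewrite /z xQ in_cons eqxx (negbTE xs) /= addr0.
  by rewrite (negbTE gxQ) addr0.
- by move=> p k ne; rewrite /z in_cons (negbTE ne).
Qed.

Lemma ext_wedge_columns (x : filling -> R) S :
  ext io (wedge_columns K n b) x S = \sum_(T | has_columns S T) x T.
Proof.
rewrite ext_coef_map [RHS]big_mkcond; apply: eq_bigr => T _.
rewrite -/(has_columns S T); case: ifP => _; last by rewrite rmorph0 mulr0.
by rewrite (oppr_pchar2 charK) expr1n rmorph1 mulr1.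
Qed.

Lemma ext_dprime (x : Dbasis n b -> R) S :
  ext io (dprime K n b) x S = \sum_(T | has_columns S T) x (contentD T).
Proof.
rewrite ext_comp ext_wedge_columns; apply: eq_bigr => T _.
exact: ext_comult_boxes.
Qed.

Lemma ext_dprime_dpow (v : 'I_m -> 'I_n -> R) S :
  ext io (dprime K n b) (@dpow _ _ _ b v) S = colform S (fun p => v (brow p)).
Proof. by rewrite ext_dprime; apply: eq_bigr => T _; rewrite -prod_boxes. Qed.

Lemma ext_dprime_mult (I : finType) (N : I * 'I_m -> nat) w S :
  ext io (dprime K n b) (ext io (mult K n N b) (dpow w)) S =
  \sum_(tau : {ffun box -> I} |
          [forall ij, #|[set p | (tau p == ij.1) && (brow p == ij.2)]| == N ij])
     colform S (fun p => w (tau p, brow p)).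
Proof.
by rewrite ext_dprime [RHS]exchange_big; apply: eq_bigr => T _; apply: ext_mult.
Qed.

End Columns.

(** * Sorted fillings and the map psi *)

Section Letters.
Local Open Scope nat_scope.
Variable n : nat.
Implicit Types (c : 'I_n -> nat) (x k : nat).

Definition psum c k := \sum_(i < n | i < k) c i.

Lemma psum0 c : psum c 0 = 0.
Proof. by rewrite /psum big_pred0. Qed.

Lemma psum_all c : psum c n = \sum_i c i.
Proof. by apply: eq_bigl => i; rewrite ltn_ord. Qed.

Lemma psumS c (k : 'I_n) : psum c k.+1 = psum c k + c k.
Proof.
rewrite /psum (bigD1 k) //= addnC; congr (_ + _); apply: eq_bigl => i.
by rewrite ltnS ltn_neqAle andbC.
Qed.

Lemma leq_psum c k1 k2 : k1 <= k2 -> psum c k1 <= psum c k2.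
Proof.
move=> h; rewrite /psum [X in _ <= X](bigID (fun i : 'I_n => i < k1)) /=.
apply: leq_trans (leq_addr _ _); rewrite leq_eqVlt; apply/orP; left.
apply/eqP; apply: eq_bigl => i; apply/idP/andP => [ik|[]//].
by split=> //; apply: leq_trans h.
Qed.

Fact letter_subproof c x :
  x < \sum_i c i -> exists k : 'I_n, psum c k <= x < psum c k.+1.
Proof.
rewrite -psum_all => xn.
have [k xk kmin] := @ex_minnP (fun k => x < psum c k) (ex_intro _ n xn).
case: k xk kmin => [|k] xk kmin; first by rewrite psum0 in xk.
have kn : k < n by apply: kmin.
exists (Ordinal kn) => /=; rewrite xk andbT leqNgt.
by apply/negP => /kmin; rewrite ltnn.
Qed.

(* The letter at position x of the weakly increasing word of content c. *)
Definition letter c x (xc : x < \sum_i c i) : 'I_n := xchoose (letter_subproof xc).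

Lemma letter_ltn c x (xc : x < \sum_i c i) k : (letter xc < k) = (x < psum c k).
Proof.
have /andP[h1 h2] := xchooseP (letter_subproof xc).
apply/idP/idP => [h|h]; first exact: leq_trans h2 (leq_psum c h).
rewrite ltnNge; apply/negP => /(leq_psum c) h3.
by move: (leq_trans h3 h1); rewrite leqNgt h.
Qed.

Lemma ffun_ord_ltn (X : Type) (f g : X -> 'I_n) :
  (forall (z : X) (k : 'I_n), (f z < k) = (g z < k)) -> f =1 g.
Proof.
move=> h z; apply: val_inj; apply/eqP; rewrite eqn_leq.
by rewrite leqNgt -h ltnn leqNgt h ltnn.
Qed.

Lemma card_ord_interval N i j : j <= N -> #|[set x : 'I_N | i <= x < j]| = j - i.
Proof.
move=> jN; rewrite -sum1dep_card -(big_mkord (fun x => i <= x < j) (fun=> 1)).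
rewrite -big_filter sum1_size /index_iota subn0.
have -> : [seq x <- iota 0 N | i <= x < j] = iota i (j - i).
  apply: (@irr_sorted_eq _ ltn); [exact: ltn_trans|exact: ltnn| | |].
  - exact/(sorted_filter ltn_trans)/iota_ltn_sorted.
  - exact: iota_ltn_sorted.
  - by move=> x; rewrite mem_filter !mem_iota; lia.
by rewrite size_iota.
Qed.

End Letters.

Section SortedFilling.
Variables (n m : nat) (b : 'I_m -> nat).
Notation box := (box b).
Notation filling := {ffun box -> 'I_n}.

Lemma card_row_cols (i : 'I_m) (P : pred nat) :
  #|[set p : box | (brow p == i) && P (bcol p)]| = #|[set c : 'I_(b i) | P c]|.
Proof.
rewrite -[RHS](@card_imset _ _ (Tagged (fun i => 'I_(b i)))); last exact: eq_from_Tagged.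
apply: eq_card => p; rewrite inE; apply/andP/imsetP => [[/eqP <- Pp]|[c + ->]].
  by exists (tagged p); [rewrite inE | case: p Pp].
by rewrite inE /brow /bcol /= eqxx.
Qed.

Section Fill.
Variables (A : 'I_m -> 'I_n -> nat) (Ab : forall i, (\sum_k A i k = b i)%N).

Fact sorted_filling_subproof (p : box) : (bcol p < \sum_k A (brow p) k)%N.
Proof. by rewrite Ab /bcol; case: p => i []. Qed.

Definition sorted_filling : filling :=
  [ffun p => letter (sorted_filling_subproof p)].

Lemma sorted_filling_ltn p k :
  (sorted_filling p < k)%N = (bcol p < psum (A (brow p)) k)%N.
Proof. by rewrite ffunE letter_ltn. Qed.

Lemma card_sorted_filling i k :
  #|[set p | (brow p == i) && (sorted_filling p == k)]| = A i k.
Proof.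
rewrite -(addKn (psum (A i) k) (A i k)) -psumS -(@card_ord_interval (b i)).
  rewrite -(@card_row_cols i (fun c => psum (A i) k <= c < psum (A i) k.+1)%N).
  apply: eq_card => p; rewrite !inE; case: eqP => //= <-.
  have := sorted_filling_ltn p k; have := sorted_filling_ltn p k.+1.
  by rewrite -val_eqE /=; lia.
by rewrite -Ab -psum_all leq_psum.
Qed.

(** In a weakly increasing row the boxes with letter below [k] form an initial segment, whose length
    is determined by the content. *)
Lemma sorted_filling_unique (T : filling) :
  (forall p q, brow p = brow q -> (bcol p <= bcol q)%N -> (T p <= T q)%N) ->
  (forall i k, #|[set p | (brow p == i) && (T p == k)]| = A i k) ->
  T = sorted_filling.
Proof.
move=> Trow TA; apply/ffunP; apply: ffun_ord_ltn => p k.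
rewrite sorted_filling_ltn.
have -> : psum (A (brow p)) k = #|[set q | (brow q == brow p) && (T q < k)%N]|.
  rewrite -sum1dep_card (partition_big T (fun j => j < k)%N) => [|q /andP[]//].
  apply: eq_bigr => j jk; rewrite -TA -sum1dep_card; apply: eq_bigl => q.
  by case: (eqVneq (T q) j) => [->|]; rewrite ?andbF // jk !andbT.
have rowp t : (t <= b (brow p))%N ->
    #|[set q : box | (brow q == brow p) && (bcol q < t)%N]| = t.
  move=> tb; rewrite (card_row_cols (brow p) (fun c => c < t)%N).
  by rewrite -[RHS]subn0 -(card_ord_interval 0 tb); apply: eq_card => q; rewrite !inE.
have pb : (bcol p < b (brow p))%N by rewrite /bcol; case: p {Trow rowp} => i [].
apply/idP/idP => [Tp|].
  rewrite -(rowp _ pb); apply: subset_leq_card; apply/subsetP => q.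
  rewrite !inE => /andP[/eqP qp h]; rewrite qp eqxx /=.
  by apply: leq_ltn_trans Tp; apply: Trow.
apply: contraLR; rewrite -!leqNgt => kT.
rewrite -[X in (_ <= X)%N](rowp _ (ltnW pb)); apply: subset_leq_card; apply/subsetP => q.
rewrite !inE => /andP[/eqP qp h]; rewrite qp eqxx /= ltnNge.
by apply/negP => h2; move: (leq_trans kT (Trow p q (esym qp) h2)); rewrite leqNgt h.
Qed.

End Fill.
End SortedFilling.

(** * Two-rowed shapes *)

Section TwoRows.
Variables (n : nat) (mu : 'I_2 -> nat).
Hypothesis mu_part : (mu ord_max <= mu ord0)%N.
Notation box := (box mu).
Notation filling := {ffun box -> 'I_n}.

(** Letters are numbered from 0, so the smallest letter, 1 in the usual notation, is the ordinal
    with value 0. *)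
Definition bottom_pos (tau : filling) :=
  [forall p, (brow p != ord0) ==> (0 < tau p)%N].

Definition top_zero (tau : filling) :=
  [forall p, (brow p == ord0) && (bcol p < mu ord_max)%N ==> (tau p == 0 :> nat)].

Definition top_box (c : 'I_(mu ord_max)) : box :=
  mkbox (leq_trans (ltn_ord c) mu_part).
Definition bot_box (c : 'I_(mu ord_max)) : box := mkbox (ltn_ord c).

Lemma row_mu (p : box) : brow p = ord0 \/ brow p = ord_max.
Proof.
by case: (brow p) => -[|[|//]] h; [left|right]; apply: val_inj.
Qed.

Lemma bot_boxP (p : box) : brow p = ord_max -> exists c, p = bot_box c /\ bcol p = c.
Proof.
case: p => i c; rewrite /brow /= => e; subst i; exists c; split=> //.
by rewrite /bot_box /mkbox; congr Tagged; apply: val_inj.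
Qed.

Lemma filling_row_content_sum (tau : filling) j :
  (\sum_k row_content tau (k, j) = mu j)%N.
Proof.
rewrite -(contentD_subproof tau j); apply: eq_bigr => k _.
by apply: eq_card => p; rewrite !inE andbC.
Qed.

Lemma has_weight_congr (a : 'I_n -> nat) (tau tau' : filling) :
  row_content tau =1 row_content tau' -> has_weight a tau = has_weight a tau'.
Proof.
move=> e; have h (t : filling) i : #|[set p | t p == i]| = (\sum_j row_content t (i, j))%N.
  rewrite -sum1dep_card (partition_big (@brow _ mu) predT) //=.
  by apply: eq_bigr => j _; rewrite sum1dep_card.
by apply: eq_forallb => i; rewrite !h; under eq_bigr do rewrite e.
Qed.

Lemma bottom_posE (tau : filling) :
  bottom_pos tau = [forall i : 'I_n, (i == 0 :> nat) ==> (row_content tau (i, ord_max) == 0)%N].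
Proof.
apply/forallP/forallP => [h i|h p].
  apply/implyP => i0; rewrite cards_eq0; apply/eqP/setP => p; rewrite !inE.
  apply/negbTE/negP => /andP[/eqP tp /eqP bp]; move: (h p).
  by rewrite bp tp (eqP i0).
apply/implyP => bp; rewrite lt0n; apply/negP => tp; move: (h (tau p)).
rewrite tp /= cards_eq0 => /eqP/setP/(_ p); rewrite !inE eqxx /=.
by case: (row_mu p) bp => ->.
Qed.

Variable lam : 'I_n -> nat.
Hypothesis lam0 : forall i : 'I_n, i = 0 :> nat -> (mu ord_max <= lam i)%N.

Definition sort_rows (tau : filling) : filling :=
  sorted_filling (filling_row_content_sum tau).

Lemma row_content_sort_rows tau : row_content (sort_rows tau) =1 row_content tau.
Proof.
case=> k j; rewrite -(card_sorted_filling (filling_row_content_sum tau)).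
by apply: eq_card => p; rewrite !inE andbC.
Qed.

Lemma sort_rows_SST (T : filling) : semistandard T -> sort_rows T = T.
Proof.
move=> /forallP h; symmetry; apply: sorted_filling_unique => [p q pq cpq|i k].
  by move/forallP: (h p) => /(_ q)/andP[/implyP + _]; apply; rewrite pq eqxx.
by apply: eq_card => p; rewrite !inE andbC.
Qed.

Lemma sort_rows_congr tau tau' :
  row_content tau =1 row_content tau' -> sort_rows tau = sort_rows tau'.
Proof.
move=> e; apply/ffunP; apply: ffun_ord_ltn => p k; rewrite !sorted_filling_ltn.
by congr (_ < _)%N; apply: eq_bigr => i _; rewrite e.
Qed.

Lemma SST_bottom_pos T : T \in SST lam mu -> bottom_pos T.
Proof.
rewrite inE => /andP[/forallP h _]; apply/forallP => p; apply/implyP => bp.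
have bp1 : brow p = ord_max by case: (row_mu p) bp => ->.
have [c [-> _]] := bot_boxP bp1.
move/forallP: (h (top_box c)) => /(_ (bot_box c))/andP[_].
by rewrite /bcol /brow /= eqxx /=; apply: leq_trans.
Qed.

(** All smallest letters lie in the first row and there are at least [mu ord_max] of them, so after
    sorting they cover the tops of all columns of height two, above larger letters. *)
Lemma sort_rows_in_SST tau :
  has_weight lam tau -> bottom_pos tau -> sort_rows tau \in SST lam mu.
Proof.
move=> tw tb; rewrite inE; apply/andP; split; last first.
  by rewrite (has_weight_congr _ (row_content_sort_rows tau)).
apply/forallP => p; apply/forallP => q; apply/andP; split; apply/implyP.
  case/andP => /eqP pq cpq; rewrite leqNgt sorted_filling_ltn -leqNgt -pq.
  apply: leq_trans cpq; rewrite leqNgt.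
  by rewrite -(sorted_filling_ltn (filling_row_content_sum tau) p) ltnn.
have {}sb : bottom_pos (sort_rows tau).
  move: tb; rewrite !bottom_posE => /forallP h; apply/forallP => i.
  by rewrite row_content_sort_rows.
case/andP => /eqP cpq rpq.
have [rp rq] : brow p = ord0 /\ brow q = ord_max.
  by case: (row_mu p) rpq => ->; case: (row_mu q) => ->.
apply: (@leq_trans 1); last by move/forallP: sb => /(_ q); rewrite rq.
rewrite sorted_filling_ltn rp cpq.
have [c [-> cq]] := bot_boxP rq; rewrite /bcol /=.
have n0 : (0 < n)%N by apply: leq_ltn_trans (ltn_ord (tau p)).
rewrite /psum (big_pred1 (Ordinal n0)) => [|i]; last first.
  by rewrite /= -val_eqE ltnS leqn0.
apply: leq_trans (ltn_ord c) _; apply: leq_trans (lam0 (i := Ordinal n0) erefl) _.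
move/forallP: tw => /(_ (Ordinal n0))/eqP <-; apply: subset_leq_card.
apply/subsetP => x; rewrite !inE => /eqP tx; rewrite tx eqxx /=.
by case: (row_mu x) => // rx; move/forallP: tb => /(_ x); rewrite rx tx.
Qed.

Variables (K : fieldType) (R : comNzRingType) (io : {rmorphism K -> R}).
Variables (charR : 2%N \in [pchar R]) (charK : 2%N \in [pchar K]).

(** The map psi followed by the inclusion of the Weyl module into a tensor product of exterior
    powers, where coordinates are available. *)
Definition psiD : 'Hom(D K n lam, free K (ext_basis n mu)) :=
  (dprime K n mu \o \sum_(T in SST lam mu)
     (mult K n (row_content T) mu \o comult K n lam (row_content T)))%VF.

Lemma psi_eq0 x : (psi K lam mu x == 0) = (psiD x == 0).
Proof.
have -> : psi K lam mu x = vsproj (limg (dprime K n mu)) (psiD x).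
  rewrite /psi /psiD comp_lfunE !sum_lfunE linear_sum linear_sum.
  apply: eq_bigr => T _; rewrite /phi /piWeyl !comp_lfunE lfunE /=.
  by [].
apply/eqP/eqP => [h|->]; last by rewrite linear0.
have : vsval (vsproj (limg (dprime K n mu)) (psiD x)) = 0 by rewrite h linear0.
by rewrite vsprojK // /psiD comp_lfunE memv_img ?memvf.
Qed.

(** A tableau [T] contributes the fillings with the row contents of [T]. Sorting the rows assigns
    exactly one such tableau to every filling of weight [lam] without a smallest letter in the
    second row. *)
Lemma ext_psiD v S :
  ext io psiD (@dpow _ _ _ lam v) S =
  \sum_(tau : filling | has_weight lam tau && bottom_pos tau)
     colform S (fun p => v (tau p)).
Proof.
rewrite ext_comp.
have -> : ext io (dprime K n mu) (ext io (\sum_(T in SST lam mu)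
     (mult K n (row_content T) mu \o comult K n lam (row_content T)))%VF (@dpow _ _ _ lam v)) S
  = \sum_(T in SST lam mu) ext io (dprime K n mu)
       (ext io (mult K n (row_content T) mu) (dpow (fun ij => v ij.1))) S.
  transitivity (ext io (dprime K n mu) (fun B => \sum_(T in SST lam mu)
      1 * ext io (mult K n (row_content T) mu) (dpow (fun ij => v ij.1)) B) S); last first.
    by rewrite ext_sumr; apply: eq_bigr => T _; rewrite mul1r.
  apply: eq_ext => B.
  rewrite ext_sum; apply: eq_bigr => T; rewrite inE => /andP[_ /forallP Tw].
  rewrite mul1r ext_comp; apply: eq_ext => C; apply: ext_comult => i.
  rewrite -(eqP (Tw i)) -[RHS]sum1dep_card (partition_big (@brow _ mu) predT) //=.
  by apply: eq_bigr => j _; rewrite sum1dep_card.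
rewrite [RHS](partition_big sort_rows (mem (SST lam mu))) /=; last first.
  by move=> tau /andP[]; apply: sort_rows_in_SST.
apply: eq_bigr => T TS; rewrite (ext_dprime_mult _ charK).
have TSS : semistandard T by move: TS; rewrite inE => /andP[].
apply: eq_bigl => tau; apply/forallP/andP => [h|[_ /eqP tT] ij].
  have e : row_content tau =1 row_content T by move=> ij; move: (h ij) => /eqP.
  split; last by rewrite (sort_rows_congr e) sort_rows_SST.
  rewrite (has_weight_congr _ e) !bottom_posE.
  apply/andP; split; first by move: TS; rewrite inE => /andP[].
  move: (SST_bottom_pos TS); rewrite bottom_posE => /forallP hb.
  by apply/forallP => i; rewrite e.
by rewrite -tT row_content_sort_rows.
Qed.

Definition swap_col (tau : filling) c : filling :=
  [ffun p => tau (tperm (top_box c) (bot_box c) p)].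

Definition pick_pos (tau : filling) :=
  [pick c | (0 < tau (top_box c))%N && (0 < tau (bot_box c))%N].

Definition swap_pos (tau : filling) : filling :=
  if pick_pos tau is Some c then swap_col tau c else tau.

(** The condition on a column is symmetric in its two boxes, so the exchange leaves the chosen
    column the same and [swap_pos] is an involution. *)
Lemma pick_pos_swap_col tau c : pick_pos (swap_col tau c) = pick_pos tau.
Proof.
apply: eq_pick => c'; rewrite !ffunE.
case: (eqVneq c c') => [->|ne]; first by rewrite tpermL tpermR andbC.
have d (p q : box) : bcol p != bcol q -> p != q by apply: contraNneq => ->.
by rewrite !tpermD //; apply: d.
Qed.

Lemma swap_posK : involutive swap_pos.
Proof.
move=> tau; rewrite {2}/swap_pos; case e: (pick_pos tau) => [c|]; last first.
  by rewrite /swap_pos e.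
rewrite /swap_pos pick_pos_swap_col e; apply/ffunP => p.
by rewrite !ffunE tpermK.
Qed.

Lemma has_weight_swap_col a tau c :
  has_weight a (swap_col tau c) = has_weight a tau.
Proof.
apply: eq_forallb => i; congr (_ == _).
rewrite -[RHS](card_imset _ (@perm_inj _ (tperm (top_box c) (bot_box c)))).
apply: eq_card => p; rewrite inE ffunE; apply/idP/imsetP => [h|[q + ->]].
  by exists (tperm (top_box c) (bot_box c) p); rewrite ?inE ?tpermK.
by rewrite inE tpermK.
Qed.

(* The fillings left after cancelling by the exchanges of the boxes of a column. *)
Definition first_kind (a : 'I_n -> nat) (tau : filling) :=
  [&& has_weight a tau, bottom_pos tau & top_zero tau].

(** The involution [swap_pos] acts on the fillings violating [top_zero]: such a filling has a column
    of height two without the smallest letter. A filling fixed by it has equal letters in a column,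
    and its column form vanishes. *)
Lemma sum_first_kind (v : 'I_n -> 'I_n -> R) S :
  \sum_(tau : filling | has_weight lam tau && bottom_pos tau)
     colform S (fun p => v (tau p)) =
  \sum_(tau | first_kind lam tau) colform S (fun p => v (tau p)).
Proof.
rewrite (bigID top_zero) /= [X in _ + X](sum_involution charR (g := swap_pos)).
- by rewrite addr0; apply: eq_bigl => tau; rewrite /first_kind andbA.
- exact: swap_posK.
- move=> tau /andP[/andP[tw tb] tt]; rewrite /swap_pos.
  case e: (pick_pos tau) => [c|]; last by rewrite tw tb.
  move: e; rewrite /pick_pos; case: pickP => // c' /andP[h1 h2] [e]; subst c'.
  rewrite has_weight_swap_col tw /=; apply/andP; split.
    apply/forallP => p; apply/implyP => bp; rewrite ffunE.
    by case: tpermP => // _ _; move/forallP: tb => /(_ p)/implyP; apply.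
  apply/negP => /forallP/(_ (top_box c)); rewrite ffunE tpermL /bcol /= ltn_ord.
  by rewrite /= eqn0Ngt h2.
- move=> tau; rewrite /swap_pos; case: (pick_pos tau) => // c.
  rewrite -[RHS](colform_tperm S (fun p => v (tau p)) (p := top_box c) (q := bot_box c)) //.
  by apply: eq_colform => p k; rewrite ffunE.
- move=> tau /andP[/andP[tw tb]] + fix_tau.
  rewrite negb_forall => /existsP[p]; rewrite negb_imply => /andP[/andP[rp cp] tp].
  have pE : p = top_box (Ordinal cp) by apply: box_inj; rewrite ?(eqP rp).
  have hp : (0 < tau (top_box (Ordinal cp)))%N by rewrite -pE lt0n.
  have hb : (0 < tau (bot_box (Ordinal cp)))%N.
    by move/forallP: tb => /(_ (bot_box (Ordinal cp)))/implyP; apply.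
  move: fix_tau; rewrite /swap_pos; case e: (pick_pos tau) => [c|]; last first.
    by move: e; rewrite /pick_pos; case: pickP => // /(_ (Ordinal cp)); rewrite hp hb.
  move=> /ffunP/(_ (bot_box c)); rewrite ffunE tpermR => tbE.
  apply: (colform_eq0 charR _ (p := top_box c) (q := bot_box c)) => //.
  by move=> k; rewrite tbE.
Qed.

Lemma ext_psiD_first_kind v S :
  ext io psiD (@dpow _ _ _ lam v) S =
  \sum_(tau | first_kind lam tau) colform S (fun p => v (tau p)).
Proof. by rewrite ext_psiD sum_first_kind. Qed.

End TwoRows.

(** * Shears and the components of square *)

Lemma prod_add_cond (R : comNzRingType) (X : finType) (F G : X -> R) (P : {set X}) :
  \prod_p (F p + (if p \in P then G p else 0)) =
  \sum_(Q : {set X} | Q \subset P) \prod_p (if p \in Q then G p else F p).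
Proof.
rewrite (eq_bigr (fun p => (if p \in P then G p else 0) + F p)); last first.
  by move=> p _; rewrite addrC.
rewrite bigA_distr (bigID (fun Q : {set X} => Q \subset P)) /= [X in _ + X]big1 ?addr0.
  apply: eq_bigr => Q /subsetP QP; apply: eq_bigr => p _.
  by case: ifP => // /QP ->.
move=> Q /subsetPn[p pQ pP]; rewrite (bigD1 p) //= pQ (negbTE pP) mul0r //.
Qed.

Section RingMorphism.
Variables (K : fieldType) (R R' : comNzRingType) (io : {rmorphism K -> R}).
Variable (phi : {rmorphism R -> R'}).

Lemma ext_rmorph (A B : finType) (f : 'Hom(free K A, free K B)) x b :
  ext (phi \o io) f (phi \o x) b = phi (ext io f x b).
Proof. by rewrite rmorph_sum; apply: eq_bigr => a _; rewrite rmorphM. Qed.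

Lemma dpow_rmorph n (I : finType) (N : I -> nat) (v : I -> 'I_n -> R) C :
  @dpow _ _ _ N (fun i k => phi (v i k)) C = phi (dpow v C).
Proof.
rewrite /dpow rmorph_prod; apply: eq_bigr => i _; rewrite rmorph_prod.
by apply: eq_bigr => k _; rewrite rmorphXn.
Qed.

Lemma colform_rmorph n m (b : 'I_m -> nat) (S : ext_basis n b) y :
  colform S (fun p k => phi (y p k)) = phi (colform S y).
Proof.
by rewrite rmorph_sum; apply: eq_bigr => T _; rewrite rmorph_prod.
Qed.

End RingMorphism.

Section Shear.
Variables (K : fieldType) (R : comNzRingType) (io : {rmorphism K -> R}).
Variables (n : nat) (lam : 'I_n -> nat).
Implicit Types (x : sq_index lam) (v : 'I_n -> 'I_n -> R).

Lemma sq_s1E x : sq_s1 x = (sq_s x).+1 :> nat.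
Proof. by rewrite /sq_s1 /sq_s; exact/eqP/(valP (tag x)). Qed.

Lemma sq_s_neq x : (sq_s x == sq_s1 x) = false.
Proof. by rewrite -val_eqE /= sq_s1E ltn_eqF. Qed.

Lemma sq_t_leq x : (sq_t x <= lam (sq_s1 x))%N.
Proof. by rewrite /sq_t /sq_s1; case: x => p []. Qed.

Lemma sq_index_ex (s s1 : 'I_n) t : s1 = s.+1 :> nat -> (0 < t <= lam s1)%N ->
  exists x, [/\ sq_s x = s, sq_s1 x = s1 & sq_t x = t].
Proof.
move=> /eqP e /andP[t0 tl].
have h : (t.-1 < lam s1)%N by rewrite prednK.
exists (Tagged (fun p : {ij : 'I_n * 'I_n | ij.2 == ij.1.+1 :> nat} => 'I_(lam (val p).2))
  (Ordinal h : (fun p => 'I_(lam (val p).2)) (exist _ (s, s1) e))).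
by split=> //; rewrite /sq_t /= prednK.
Qed.

Lemma sq_index_inj x y : sq_s1 x = sq_s1 y -> sq_t x = sq_t y -> x = y.
Proof.
move=> e1; have := sq_s1E y; rewrite -e1 sq_s1E => -[/val_inj].
move: e1; case: x y => [[[s s1] h] c] [[[s' s1'] h'] c'].
rewrite /sq_s1 /sq_s /sq_t /= => e e'; subst s' s1'.
have hh : h = h' by apply: bool_irrelevance.
by subst h'; case=> cc; congr existT; apply: val_inj.
Qed.

(** Every basis monomial is the content of a filling, so coordinates in [D(lam)] can be computed as
    products over boxes. *)
Lemma contentD_sorted (A : Dbasis n lam) : contentD (sorted_filling (sum_expo A)) = A.
Proof.
by apply: Dbasis_inj => i k; rewrite expo_contentD card_sorted_filling.
Qed.

Lemma card_row (i : 'I_n) : #|[set p : box lam | brow p == i]| = lam i.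
Proof.
rewrite -(subn0 (lam i)) -(card_ord_interval 0 (leqnn _)).
rewrite -(@card_row_cols _ lam i (fun c => 0 <= c < lam i)%N).
apply: eq_card => p; rewrite !inE; case: eqP => //= <-.
by rewrite /bcol; case: p => j [].
Qed.

(** In [ext_mult] the labels equal the rows except on a set [Q] of [sq_t x] boxes of row [sq_s1 x],
    which are labelled [sq_s x]; [lab] and [moved] translate between labellings and such sets. *)
Lemma ext_sq_component x v (T : {ffun box lam -> 'I_n}) :
  ext io (sq_component K x) (@dpow _ _ _ (sq_wt x) v) (contentD T) =
  \sum_(Q : {set box lam} | (Q \subset [set p | brow p == sq_s1 x]) && (#|Q| == sq_t x))
     \prod_p v (if p \in Q then sq_s x else brow p) (T p).
Proof.
rewrite ext_comp.
have sw i : (\sum_j sq_mx x (i, j) = sq_wt x i)%N.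
  rewrite /sq_wt /sq_mx (bigD1 i) //= eqxx.
  case: (eqVneq i (sq_s x)) => [->|ne].
    rewrite sq_s_neq (bigD1 (sq_s1 x)) /=; last by rewrite eq_sym sq_s_neq.
    rewrite sq_s_neq !eqxx /=.
    rewrite big1 ?addn0 // => j /andP[j1 j2].
    by rewrite eq_sym (negbTE j1) (negbTE j2).
  by rewrite big1 ?addn0 // => j; rewrite eq_sym => /negbTE ->.
rewrite (eq_ext _ _ (ext_comult io v sw)) ext_mult /=.
pose lab (Q : {set box lam}) : {ffun box lam -> 'I_n} :=
  [ffun p => if p \in Q then sq_s x else brow p].
pose moved (tau : {ffun box lam -> 'I_n}) :=
  [set p : box lam | (brow p == sq_s1 x) && (tau p == sq_s x)].
rewrite (reindex_onto lab moved) /=; last first.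
  move=> tau /forallP h; apply/ffunP => p; rewrite ffunE inE.
  have : (0 < sq_mx x (tau p, brow p))%N.
    by rewrite -(eqP (h (_, _))) (cardsD1 p) inE !eqxx.
  rewrite /sq_mx; case: eqP => [->|_].
    by case: (eqVneq (brow p) (sq_s1 x)) => //= ->; rewrite eq_sym sq_s_neq.
  by case: ifP => // /andP[/eqP -> ->] /=; rewrite eqxx.
apply: eq_big => [Q|Q _]; last by apply: eq_bigr => p _; rewrite ffunE.
have QK : (moved (lab Q) == Q) = (Q \subset [set p | brow p == sq_s1 x]).
  apply/eqP/subsetP => [<- p|QP]; first by rewrite !inE => /andP[].
  apply/setP => p; rewrite inE ffunE; case: ifP => [pQ|pQ].
    by move: (QP p pQ); rewrite inE eqxx => ->.
  by case: eqP => //= ->; rewrite eq_sym sq_s_neq.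
rewrite QK andbC; case: (boolP (Q \subset _)) => //= /subsetP QP.
have labE p i j : (lab Q p == i) && (brow p == j) =
    if i == j then (p \notin Q) && (brow p == j)
    else [&& i == sq_s x, j == sq_s1 x & p \in Q].
  rewrite ffunE; case: ifP => [pQ|pQ] /=.
    move: (QP p pQ); rewrite inE => /eqP ->.
    case: (eqVneq i j) => [->|ij].
      by rewrite andbC; case: (eqVneq (sq_s1 x) j) => //= <-; rewrite sq_s_neq.
    by rewrite andbT eq_sym [sq_s1 x == j]eq_sym.
  case: (eqVneq i j) => [->|ij]; first by rewrite andbb.
  by rewrite !andbF; case: (eqVneq (brow p) i) => //= ->; rewrite (negbTE ij).
have cQ : #|Q| = (lam (sq_s1 x) - #|[set p | (p \notin Q) && (brow p == sq_s1 x)]|)%N.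
  rewrite -card_row -(cardsID Q [set p | brow p == sq_s1 x]) -[X in (_ - X)%N](_ : #|[set p | brow p == sq_s1 x] :\: Q| = _).
    rewrite addnK; apply: eq_card => p; rewrite !inE.
    by case: (boolP (p \in Q)) => [/QP|]; rewrite ?andbF // inE => ->.
  by apply: eq_card => p; rewrite !inE.
have cle : (#|[set p | (p \notin Q) && (brow p == sq_s1 x)]| <= lam (sq_s1 x))%N.
  rewrite -card_row; apply: subset_leq_card; apply/subsetP => p.
  by rewrite !inE => /andP[].
apply/forallP/eqP => [h|Qt [i j]].
  move: (h (sq_s1 x, sq_s1 x)) => /eqP /=; rewrite !eqxx cQ.
  rewrite (eq_card (B := [set p | (p \notin Q) && (brow p == sq_s1 x)])) => [->|p].
    by rewrite subKn // sq_t_leq.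
  by rewrite !inE labE eqxx.
rewrite /=; case: (eqVneq i j) => [<-|ij].
  rewrite (eq_card (B := [set p | (p \notin Q) && (brow p == i)])); last first.
    by move=> p; rewrite !inE labE eqxx.
  case: (eqVneq i (sq_s1 x)) => [->|ne]; first by rewrite -Qt cQ subKn.
  rewrite -card_row; apply/eqP/eq_card => p; rewrite !inE.
  case: (boolP (p \in Q)) => [/QP|] //=; rewrite inE => /eqP ->.
  by rewrite eq_sym (negbTE ne).
rewrite (eq_card (B := [set p | [&& i == sq_s x, j == sq_s1 x & p \in Q]])); last first.
  by move=> p; rewrite !inE labE (negbTE ij).
case: ifP => [/andP[-> ->]|h] /=; first by rewrite -Qt; apply/eqP/eq_card => p; rewrite inE.
apply/eqP; rewrite -(cards0 (box lam)); apply: eq_card => p; rewrite !inE.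
by rewrite andbA h.
Qed.

Definition shear (s s1 : 'I_n) (u : R) v i k : R :=
  v i k + (if i == s1 then u * v s k else 0).

(* Nonempty sets of boxes in row s1 are sorted by their cardinality t, i.e. by
   the pairs (s, t) indexing the summands of \square. *)
Lemma sum_by_sq_t (X : finType) (s s1 : 'I_n) (F : {set X} -> R) (P : pred {set X}) :
  s1 = s.+1 :> nat -> (forall Q, P Q -> #|Q| <= lam s1)%N -> P set0 ->
  \sum_(Q | P Q) F Q =
  F set0 + \sum_(x : sq_index lam | sq_s1 x == s1)
              \sum_(Q | P Q && (#|Q| == sq_t x)) F Q.
Proof.
move=> ss Pl P0; rewrite (bigD1 set0) //=; congr (_ + _).
rewrite (exchange_big_dep P) => [|x Q _ /andP[]//] /=.
rewrite [RHS](bigID (fun Q => Q == set0)) /= [X in X + _]big1 ?add0r; last first.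
  by move=> Q /andP[_ /eqP ->]; rewrite big_pred0 // => x; rewrite cards0 andbA andbF.
apply: eq_bigr => Q /andP[PQ Q0].
have [x [e1 e2 e3]] := @sq_index_ex s s1 #|Q| ss
  (introT andP (conj (etrans (card_gt0 Q) Q0) (Pl Q PQ))).
rewrite (big_pred1 x) // => y; rewrite PQ /=; apply/andP/eqP => [[/eqP h1 /eqP h2]|->].
  by apply: sq_index_inj; [rewrite h1 e2|rewrite -h2 e3].
by rewrite e2 e3 !eqxx.
Qed.

(** The factors of row [s1] are expanded: taking the new summand at exactly t boxes gives the
    component indexed by s and t, with the factor u^t. *)
Lemma dpow_shear (s s1 : 'I_n) u v A : s1 = s.+1 :> nat ->
  @dpow _ _ _ lam (shear s s1 u v) A =
  dpow v A + \sum_(x : sq_index lam | sq_s1 x == s1)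
    u ^+ sq_t x * ext io (sq_component K x) (@dpow _ _ _ (sq_wt x) v) A.
Proof.
move=> ss; rewrite -(contentD_sorted A); set T := sorted_filling _.
rewrite -!prod_boxes.
rewrite (eq_bigr (fun p => v (brow p) (T p) +
  (if p \in [set p | brow p == s1] then u * v s (T p) else 0))); last first.
  by move=> p _; rewrite inE.
rewrite prod_add_cond (sum_by_sq_t _ ss) ?sub0set //; last first.
  by move=> Q h; rewrite -card_row; apply: subset_leq_card.
congr (_ + _); first by apply: eq_bigr => p _; rewrite inE.
apply: eq_bigr => x /eqP xs; rewrite ext_sq_component big_distrr /= xs.
have -> : sq_s x = s by apply: val_inj; apply/eqP; rewrite -eqSS -sq_s1E xs ss.
apply: eq_bigr => Q /andP[_ /eqP <-].
rewrite -prodr_const [X in _ = X * _]big_mkcond -big_split /=.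
by apply: eq_bigr => p _; case: ifP => //; rewrite mul1r.
Qed.

End Shear.

(** * The composites of psi with the components of square *)

Section ShearPsi.
Variables (n : nat) (mu : 'I_2 -> nat).
Hypothesis mu_part : (mu ord_max <= mu ord0)%N.
Notation box := (box mu).
Notation filling := {ffun box -> 'I_n}.
Variable lam : 'I_n -> nat.
Hypothesis lam0 : forall i : 'I_n, i = 0 :> nat -> (mu ord_max <= lam i)%N.

(* If s is the first letter, then shearing does not matter in the second row: the
   box above carries v_s. *)
Definition free_boxes (s : 'I_n) : {set box} :=
  [set p | (s == 0 :> nat) ==> (mu ord_max <= bcol p)%N].

Definition relabel (tau : filling) (Q : {set box}) (s : 'I_n) : filling :=
  [ffun p => if p \in Q then s else tau p].

Lemma bcol_bottom (p : box) : brow p = ord_max -> (bcol p < mu ord_max)%N.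
Proof. by case/bot_boxP => c [_ ->]. Qed.

Lemma has_weight_relabel (x : sq_index lam) (tau : filling) (Q : {set box}) :
  Q \subset [set p | tau p == sq_s x] -> #|Q| = sq_t x ->
  has_weight lam (relabel tau Q (sq_s1 x)) = has_weight (sq_wt x) tau.
Proof.
move=> /subsetP Qs Qt; apply: eq_forallb => i.
have st := sq_t_leq x; have sn := sq_s_neq x.
(* The balance of letters is stated additively because [sq_wt] involves a truncated subtraction. *)
have e : (#|[set p | relabel tau Q (sq_s1 x) p == i]| + (i == sq_s x) * sq_t x =
          #|[set p | tau p == i]| + (i == sq_s1 x) * sq_t x)%N.
  rewrite -(cardsID Q [set p | relabel tau Q (sq_s1 x) p == i]).
  rewrite -(cardsID Q [set p | tau p == i]).
  have -> : [set p | relabel tau Q (sq_s1 x) p == i] :\: Q = [set p | tau p == i] :\: Q.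
    by apply/setP => p; rewrite !inE ffunE; case: (p \in Q).
  have -> : #|[set p | relabel tau Q (sq_s1 x) p == i] :&: Q| = ((i == sq_s1 x) * sq_t x)%N.
    case: eqVneq => [->|ne].
      rewrite mul1n -Qt; apply: eq_card => p; rewrite !inE ffunE andbC.
      by case: (p \in Q); rewrite //= eqxx.
    rewrite mul0n; apply: eq_card0 => p; rewrite !inE ffunE andbC.
    by case: (p \in Q); rewrite //= eq_sym (negbTE ne).
  have -> : #|[set p | tau p == i] :&: Q| = ((i == sq_s x) * sq_t x)%N.
    case: eqVneq => [->|ne].
      rewrite mul1n -Qt; apply: eq_card => p; rewrite !inE andbC.
      by case: (boolP (p \in Q)) => //= /Qs; rewrite inE.
    rewrite mul0n; apply: eq_card0 => p; rewrite !inE andbC.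
    case: (boolP (p \in Q)) => //= /Qs; rewrite inE => /eqP ->.
    by rewrite eq_sym (negbTE ne).
  by rewrite addnC [X in (_ + X)%N]addnC addnA.
rewrite /sq_wt; case: (eqVneq i (sq_s x)) e => [->|ne].
  by rewrite sn mul1n mul0n addn0 => <-; rewrite eqn_add2r.
case: (eqVneq i (sq_s1 x)) => [->|ne1]; last by rewrite !mul0n !addn0 => ->.
by rewrite mul0n mul1n addn0 => ->; apply/eqP/eqP; lia.
Qed.

(** The new letter is never the smallest. If the old one is, then [Q] avoids the columns of height
    two, the only ones constrained by [bottom_pos] and [top_zero]. *)
Lemma first_kind_relabel (x : sq_index lam) (tau : filling) (Q : {set box}) :
  Q \subset [set p | tau p == sq_s x] -> Q \subset free_boxes (sq_s x) ->
  #|Q| = sq_t x ->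
  first_kind lam (relabel tau Q (sq_s1 x)) = first_kind (sq_wt x) tau.
Proof.
move=> Qs /subsetP Qf Qt; rewrite /first_kind has_weight_relabel //.
congr (_ && _); move/subsetP: Qs => Qs.
have s1p : (0 < sq_s1 x)%N by rewrite sq_s1E.
congr (_ && _); apply: eq_forallb => p; rewrite ffunE; case: ifP => // pQ.
  move: (Qs p pQ) (Qf p pQ); rewrite !inE => /eqP -> h; rewrite s1p.
  case: (row_mu p) => [->|rp] //; rewrite rp /=; move: h.
  by rewrite leqNgt (bcol_bottom rp) implybF lt0n => ->.
move: (Qs p pQ) (Qf p pQ); rewrite !inE => /eqP -> h.
rewrite eqn0Ngt s1p /=; move: h; rewrite leqNgt.
by case: (bcol p < _)%N; rewrite ?andbF //= implybF => /negbTE ->.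
Qed.

(** If [s] is the smallest letter, the boxes outside [free_boxes s] that carry it are exactly the
    tops of the columns of height two. *)
Lemma card_free_boxes (a : 'I_n -> nat) (s : 'I_n) (tau : filling) : first_kind a tau ->
  #|free_boxes s :&: [set p | tau p == s]| =
  (a s - (if s == 0 :> nat then mu ord_max else 0))%N.
Proof.
case/and3P => /forallP/(_ s)/eqP <- /forallP tb /forallP tt.
rewrite -(cardsID (free_boxes s) [set p | tau p == s]) setIC.
rewrite -[in LHS](addnK #|[set p | tau p == s] :\: free_boxes s| #|_ :&: _|).
congr (_ - _)%N; case: eqP => s0; last first.
  apply: eq_card0 => p; rewrite !inE.
  by rewrite (introF eqP s0).
rewrite -[RHS]card_ord -(@card_imset _ _ (top_box mu_part)).
  apply: eq_card => p; rewrite !inE s0 /= -ltnNge; apply/andP/imsetP => [[h1 h2]|[c _ ->]].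
    exists (Ordinal h1) => //; apply: box_inj => //; rewrite /brow /=.
    case: (row_mu p) => // rp; move: (tb p); rewrite rp (eqP h2) s0 //.
  split; first by rewrite /bcol /= ltn_ord.
  by move: (tt (top_box mu_part c)); rewrite /bcol /brow /= ltn_ord -val_eqE /= s0.
by move=> c d [e]; apply: val_inj.
Qed.

Variables (K : fieldType) (R : comNzRingType) (io : {rmorphism K -> R}).
Variables (charR : 2%N \in [pchar R]) (charK : 2%N \in [pchar K]).

(** If [s] is the smallest letter, a column of height two has [v s] on top, and adding a multiple of
    [v s] below does not change the column form. The factors of the remaining boxes are expanded. *)
Lemma colform_shear_first_kind (s s1 : 'I_n) (u : R) (v : 'I_n -> 'I_n -> R) S (tau : filling) :
  s1 = s.+1 :> nat -> first_kind lam tau ->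
  colform S (fun p => shear s s1 u v (tau p)) =
  \sum_(Q : {set box} | Q \subset (free_boxes s :&: [set p | tau p == s1]))
     u ^+ #|Q| * colform S (fun p => v (relabel tau Q s p)).
Proof.
move=> ss /and3P[_ _ /forallP tt].
pose y (p : box) k : R := v (tau p) k +
  (if p \in free_boxes s :&: [set p | tau p == s1] then u * v s k else 0).
transitivity (colform S y).
  (* [g] sends a box in a column of height two to the top of that column, where the smallest letter
     stands. *)
  pose g (p : box) := if insub (bcol p) is Some c then top_box mu_part c else p.
  apply: (colform_shear charR _ (y := y) (g := g) (u := fun=> u)
    (Q := [set p | (tau p == s1) && (p \notin free_boxes s)])).
  - move=> q; rewrite !inE /g => /andP[/eqP tq]; rewrite negb_imply -ltnNge => /andP[/eqP s0 h].
    rewrite insubT /=; split=> //.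
    move: (tt (top_box mu_part (Ordinal h))); rewrite /bcol /brow /= h /=.
    by move=> /eqP t0; rewrite -val_eqE /= t0 ss.
  - move=> q k; rewrite !inE => /andP[/eqP tq]; rewrite negb_imply -ltnNge => /andP[/eqP s0 h].
    rewrite /shear /y !inE tq eqxx s0 leqNgt h /= addr0 /g insubT /=.
    have tg : tau (top_box mu_part (Ordinal h)) = s.
      apply: val_inj; rewrite /= s0; apply/eqP.
      by move: (tt (top_box mu_part (Ordinal h))); rewrite /bcol /brow /= h.
    by rewrite tg -[s == s1]val_eqE /= ss ltn_eqF //= andbF addr0.
  - move=> q k; rewrite !inE /shear /y !inE negb_and negbK.
    by case: (tau q == s1); rewrite ?andbF //= andbT => ->.
rewrite /colform; under [RHS]eq_bigr do rewrite big_distrr /=.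
rewrite exchange_big; apply: eq_bigr => T _; rewrite /y prod_add_cond.
apply: eq_bigr => Q _; rewrite -prodr_const [X in _ = X * _]big_mkcond -[RHS]big_split /=.
rewrite [RHS](eq_bigr (fun p => if p \in Q then u * v s (T p) else v (tau p) (T p))) //.
by move=> p _; rewrite ffunE; case: ifP => //; rewrite mul1r.
Qed.

(** The number of ways to choose [sq_t x] free boxes among those carrying [sq_s x] in a filling of
    first kind and weight [sq_wt x]. *)
Definition row_shift_coef (x : sq_index lam) : nat :=
  'C(sq_wt x (sq_s x) - (if sq_s x == 0 :> nat then mu ord_max else 0), sq_t x).

(** Double counting: a filling of weight [lam] with a set of t free boxes carrying [s1] corresponds,
    by relabelling these boxes, to a filling of weight [sq_wt x] with a set of t free boxes carrying
    [s]. *)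
Lemma ext_psiD_shear (s s1 : 'I_n) (u : R) (v : 'I_n -> 'I_n -> R) S : s1 = s.+1 :> nat ->
  ext io (psiD mu lam K) (@dpow _ _ _ lam (shear s s1 u v)) S =
  ext io (psiD mu lam K) (@dpow _ _ _ lam v) S +
  \sum_(x : sq_index lam | sq_s1 x == s1)
     u ^+ sq_t x * ((row_shift_coef x)%:R *
       \sum_(tau | first_kind (sq_wt x) tau) colform S (fun p => v (tau p))).
Proof.
move=> ss; rewrite !ext_psiD_first_kind //.
under eq_bigr => tau tk.
  rewrite (colform_shear_first_kind u v S ss tk) (sum_by_sq_t (lam := lam) _ ss).
  - over.
  - move=> Q /subset_leq_card h; apply: leq_trans h _.
    case/and3P: tk => /forallP/(_ s1)/eqP <- _ _; apply: subset_leq_card.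
    exact: subsetIr.
  - exact: sub0set.
rewrite big_split /=; congr (_ + _).
  apply: eq_bigr => tau _; rewrite cards0 mul1r; apply: eq_colform => p k.
  by rewrite ffunE inE.
rewrite exchange_big /=; apply: eq_bigr => x /eqP xs.
have xss : sq_s x = s by apply: val_inj; apply/eqP; rewrite -eqSS -sq_s1E xs ss.
rewrite (exchange_big_dep (fun Q : {set box} => (Q \subset free_boxes s) && (#|Q| == sq_t x))) /=;
  last by move=> tau Q _; rewrite subsetI -andbA => /andP[-> /andP[_ ->]].
transitivity (\sum_(Q : {set box} | (Q \subset free_boxes s) && (#|Q| == sq_t x))
   \sum_(tau : filling | first_kind (sq_wt x) tau && (Q \subset [set p | tau p == s]))
      u ^+ sq_t x * colform S (fun p => v (tau p))).
  apply: eq_bigr => Q /andP[Qf /eqP Qt].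
  rewrite (reindex_onto (fun tau => relabel tau Q s1) (fun tau => relabel tau Q s)) /=.
    apply: eq_big => [tau|tau /andP[_ /eqP e]]; last first.
      by rewrite e Qt.
    have -> : (relabel (relabel tau Q s1) Q s == tau) = (Q \subset [set p | tau p == s]).
      apply/eqP/subsetP => [<- p pQ|h]; first by rewrite inE ffunE pQ.
      apply/ffunP => p; rewrite !ffunE; case: (boolP (p \in Q)) => // pQ.
      by move: (h p pQ); rewrite inE => /eqP.
    case: (boolP (Q \subset [set p | tau p == s])) => [hQ|]; last by rewrite !andbF.
    rewrite !andbT Qt eqxx andbT subsetI Qf /=.
    have -> : Q \subset [set p | relabel tau Q s1 p == s1].
      by apply/subsetP => p pQ; rewrite inE ffunE pQ.
    by rewrite andbT -xs first_kind_relabel ?xss.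
  move=> tau; rewrite subsetI => /andP[_ /andP[/andP[_ /subsetP h] _]].
  apply/ffunP => p; rewrite !ffunE; case: (boolP (p \in Q)) => // pQ.
  by move: (h p pQ); rewrite inE => /eqP.
rewrite (exchange_big_dep (first_kind (sq_wt x))) /=; last by move=> Q tau _ /andP[].
rewrite !big_distrr /=; apply: eq_bigr => tau tk.
rewrite sumr_const -[LHS]mulr_natl mulrCA; congr (_ * (_%:R * _)).
rewrite /row_shift_coef xss -(card_free_boxes s tk) -cards_draws.
apply: eq_card => Q; rewrite !inE subsetI unfold_in tk /=.
by rewrite andbAC.
Qed.

End ShearPsi.

(** * Comparison of coefficients in the shear parameter *)

Section Coefficients.
Variables (n : nat) (mu : 'I_2 -> nat).
Hypothesis mu_part : (mu ord_max <= mu ord0)%N.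
Variable lam : 'I_n -> nat.
Hypothesis lam0 : forall i : 'I_n, i = 0 :> nat -> (mu ord_max <= lam i)%N.
Variables (K : fieldType) (R : comNzRingType) (io : {rmorphism K -> R}).
Variables (charR : 2%N \in [pchar R]) (charK : 2%N \in [pchar K]).

Lemma coef_sum_sq_t (x : sq_index lam) (c : sq_index lam -> R) :
  (\sum_(y | sq_s1 y == sq_s1 x) 'X^(sq_t y) * (c y)%:P)`_(sq_t x) = c x.
Proof.
rewrite coef_sum (bigD1 x) //= coefMC coefXn eqxx mul1r big1 ?addr0 // => y.
case/andP => /eqP e ne; rewrite coefMC coefXn; case: eqP => [et|]; last by rewrite mul0r.
by case/eqP: ne; apply: sq_index_inj.
Qed.

(** With an indeterminate as shear parameter and constant vectors, [dpow_shear] and [ext_psiD_shear]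
    expand the same polynomial in two ways; the coefficients at the exponent [sq_t x] are
    compared. *)
Lemma ext_psiD_sq (x : sq_index lam) v S :
  ext io (psiD mu lam K \o sq_component K x)%VF (@dpow _ _ _ (sq_wt x) v) S =
  (row_shift_coef mu x)%:R *
    \sum_(tau : {ffun box mu -> 'I_n} | first_kind (sq_wt x) tau)
      colform S (fun p => v (tau p)).
Proof.
have charP : 2%N \in [pchar {poly R}] by rewrite pchar_poly.
pose V i k := (v i k)%:P.
have := ext_psiD_shear mu_part lam0 (polyC \o io) charP charK 'X V S (sq_s1E x).
rewrite (eq_ext _ _ (fun A => dpow_shear (polyC \o io) 'X V A (sq_s1E x))).
rewrite extD ext_sumr => /addrI /(congr1 (fun p : {poly R} => p`_(sq_t x))).
rewrite (eq_bigr (fun y => 'X^(sq_t y) *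
    (ext io (psiD mu lam K \o sq_component K y)%VF (@dpow _ _ _ (sq_wt y) v) S)%:P)).
  rewrite coef_sum_sq_t => ->.
  rewrite (eq_bigr (fun y => 'X^(sq_t y) * ((row_shift_coef mu y)%:R *
    \sum_(tau : {ffun box mu -> 'I_n} | first_kind (sq_wt y) tau)
      colform S (fun p => v (tau p)))%:P)); first by rewrite coef_sum_sq_t.
  move=> y _; congr (_ * _); rewrite polyCM polyC_natr rmorph_sum; congr (_ * _).
  by apply: eq_bigr => tau _; rewrite -colform_rmorph.
move=> y _; congr (_ * _); rewrite -ext_comp -ext_rmorph; apply: eq_ext => A.
by rewrite /= -dpow_rmorph.
Qed.

End Coefficients.

(** * Straightening *)

Section GenericMatrix.
Variables (K : fieldType) (n : nat).

Notation nvars := #|{: 'I_n * 'I_n}|.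
Notation P := {mpoly K[nvars]}.
Notation io := (@mpolyC nvars K).

Definition gen (i k : 'I_n) : P := 'X_(enum_rank (i, k)).

Definition gmon (E : 'I_n -> 'I_n -> nat) : 'X_{1.. nvars} :=
  [multinom E (enum_val j).1 (enum_val j).2 | j < nvars].

Lemma gmon_inj E F : gmon E = gmon F -> forall i k, E i k = F i k.
Proof.
move=> /mnmP h i k; have := h (enum_rank (i, k)).
by rewrite !mnmE enum_rankK.
Qed.

Lemma eq_gmon E F : (forall i k, E i k = F i k) -> gmon E = gmon F.
Proof. by move=> h; apply/mnmP => j; rewrite !mnmE. Qed.

Lemma prod_gen E : \prod_i \prod_k gen i k ^+ E i k = 'X_[gmon E].
Proof.
rewrite pair_bigA mpolyXE_id (reindex (@enum_val _ (mem {: 'I_n * 'I_n}))) /=.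
  by apply: eq_bigr => j _; rewrite mnmE /gen -surjective_pairing enum_valK.
by apply: onW_bij; apply: enum_val_bij.
Qed.

Lemma prod_gen_word (X : finType) (f g : X -> 'I_n) :
  \prod_p gen (f p) (g p) =
  'X_[gmon (fun i k => #|[set p | (f p == i) && (g p == k)]|)].
Proof.
rewrite -prod_gen (partition_big f predT) //=; apply: eq_bigr => i _.
rewrite (partition_big g predT) //=; apply: eq_bigr => k _.
rewrite -prodr_const; apply: eq_big => [p|p]; first by rewrite inE.
by case/andP => /eqP -> /eqP ->.
Qed.

(** The monomial with exponents [A] occurs only in the coordinate at [A], so its coefficient in the
    value of [f] is the value of [f] at that basis vector. *)
Lemma ext_generic_eq0 (a : 'I_n -> nat) (B : finType) (f : 'Hom(D K n a, free K B)) :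
  (forall b, ext io f (@dpow _ _ _ a gen) b = 0) -> f = 0.
Proof.
move=> h.
have f0 A b : f (delta K A) b = 0.
  have := congr1 (mcoeff (gmon (fun i k => expo (A i) k))) (h b).
  rewrite mcoeff0 /ext raddf_sum (bigD1 A) //= big1 ?addr0.
    by rewrite /dpow prod_gen mulrC mcoeffCM mcoeffX eqxx mulr1.
  move=> A' ne; rewrite /dpow prod_gen mulrC mcoeffCM mcoeffX.
  case: eqP => [/gmon_inj e|_]; last by rewrite mulr0.
  by case/eqP: ne; apply: Dbasis_inj.
apply/lfunP => x; rewrite lfunE /= (free_delta x) linear_sum big1 // => A _.
by rewrite linearZ; apply/ffunP => b; rewrite !ffunE f0 /GRing.scale /= mulr0.
Qed.

Lemma ext_id (A B : finType) (f : 'Hom(free K A, free K B)) (x : free K A) b :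
  ext idfun f x b = f x b.
Proof.
rewrite {2}(free_delta x) linear_sum sum_ffunE; apply: eq_bigr => a _.
by rewrite linearZ ffunE.
Qed.

Lemma mcoeff_ext (A B : finType) (f : 'Hom(free K A, free K B)) (x : A -> P) b m :
  (ext io f x b)@_m = f [ffun a => (x a)@_m] b.
Proof.
rewrite -ext_id /ext raddf_sum; apply: eq_bigr => a _.
by rewrite ffunE /= [in LHS]mulrC mcoeffCM mulrC.
Qed.

End GenericMatrix.

(** * The straightening relations *)

Section Straightening.
Variables (K : fieldType) (charK : 2%N \in [pchar K]) (n : nat) (lam : 'I_n -> nat).
Notation nvars := #|{: 'I_n * 'I_n}|.
Notation P := {mpoly K[nvars]}.
Notation io := (@mpolyC nvars K).
Notation x := (gen K).
Implicit Types (A B : Dbasis n lam).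

Definition statistic B := (\sum_(i < n) \sum_(k < n) i * k * expo (B i) k)%N.

Variables (s s1 m : 'I_n).
Hypothesis ss : s1 = s.+1 :> nat.

Let s_neq : (s == s1) = false.
Proof. by rewrite -val_eqE /= ss ltn_eqF. Qed.

(* Row s is a + z and row s1 is z + y, where a, z, y are generic vectors, a being
   supported on the letters below m and y on those above m. *)
Definition shuffle_rows (i k : 'I_n) : P :=
  x (if (i == s1) && (k <= m)%N then s else i) k +
  (if ((i == s) && (k < m)%N) || ((i == s1) && (m < k)%N)
   then x (if i == s then s1 else s) k else 0).

(** The exponents of the term of the coordinate at [A] in which row [s] takes a on the letters below
    [m] and z on the others, while row [s1] takes y on the letters above [m] and z on the others. *)
Definition shuffle_expo A (i k : 'I_n) : nat :=
  if i == s then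
    ((if (m <= k)%N then expo (A s) k else 0) + (if (k <= m)%N then expo (A s1) k else 0))%N
  else if i == s1 then
    ((if (k < m)%N then expo (A s) k else 0) + (if (m < k)%N then expo (A s1) k else 0))%N
  else expo (A i) k.

Definition straightening A : D K n lam :=
  [ffun B => (@dpow _ _ _ lam shuffle_rows B)@_(gmon (shuffle_expo A))].

(** In characteristic 2 the sum of a + z and z + y is a + y. As a and y occupy the letters below and
    above [m], row [s1] is again generic, except for a zero at the letter [m]. *)
Lemma shear_shuffle_rows i k :
  shear s s1 1 shuffle_rows i k =
  (if (i == s1) && (k == m) then 0 else x i k) +
  (if (i == s) && (k < m)%N then x s1 k else 0).
Proof.
have charP : 2%N \in [pchar P] by apply: (rmorph_pchar io).
have xx i' : x i' k + x i' k = 0 by rewrite addrr_pchar2.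
rewrite /shear /shuffle_rows eqxx s_neq /= orbF mul1r.
case: (eqVneq i s) => [->|ne] /=; first by rewrite s_neq /= orbF addr0.
case: (eqVneq i s1) => [->|] /=; last by rewrite !addr0.
rewrite -[k == m]val_eqE /=; case: (ltngtP k m) => [km|km|km] /=.
- by rewrite !addr0 addrA xx add0r.
- by rewrite !addr0 -addrA xx addr0.
by rewrite !addr0 xx.
Qed.

(** The degree in z is [lam s] minus the number of letters below [m] in row [s] plus the number of
    letters at most [m] in row [s1]. *)
Lemma sum_shuffle_expo A :
  (psum (expo (A s)) m < psum (expo (A s1)) m.+1)%N ->
  (lam s < \sum_k shuffle_expo A s k)%N.
Proof.
move=> h; rewrite -(sum_expo A s) (bigID (fun k : 'I_n => k < m)%N) /=.
rewrite /shuffle_expo eqxx big_split /= -!big_mkcond /=.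
rewrite -/(psum (expo (A s)) m) addnC.
rewrite (eq_bigl (fun k : 'I_n => (m <= k)%N)) => [|k]; last by rewrite -leqNgt.
by rewrite ltn_add2l.
Qed.

(** After the shear z occurs only in row [s], hence in degree at most [lam s], while the chosen
    monomial has larger degree in z. *)
Lemma straightening_ker (B : finType) (f : 'Hom(D K n lam, free K B)) A :
  (forall v b, ext io f (@dpow _ _ _ lam (shear s s1 1 v)) b =
               ext io f (@dpow _ _ _ lam v) b) ->
  (psum (expo (A s)) m < psum (expo (A s1)) m.+1)%N -> f (straightening A) = 0.
Proof.
move=> finv viol; apply/ffunP => b; rewrite -mcoeff_ext -finv mcoeff_ext.
set y := [ffun a => _]; suff -> : y = 0 by rewrite linear0.
apply/ffunP => C; rewrite !ffunE -(contentD_sorted C); set T := sorted_filling _.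
rewrite -prod_boxes.
rewrite (eq_bigr (fun p => (if (brow p == s1) && (T p == m) then 0 else x (brow p) (T p)) +
   (if p \in [set p | (brow p == s) && (T p < m)%N] then x s1 (T p) else 0))); last first.
  by move=> p _; rewrite shear_shuffle_rows inE.
rewrite prod_add_cond raddf_sum big1 // => Q _ /=.
case: (pickP (fun p => (p \notin Q) && ((brow p == s1) && (T p == m)))) => [p /andP[pQ h]|h].
  by rewrite (bigD1 p) //= (negbTE pQ) h mul0r mcoeff0.
rewrite (eq_bigr (fun p => x (if p \in Q then s1 else brow p) (T p))); last first.
  by move=> p _; move: (h p); case: (p \in Q) => //= ->.
rewrite prod_gen_word mcoeffX; case: eqP => // /gmon_inj e.
move: (sum_shuffle_expo viol); rewrite ltnNge; case/negP.
rewrite -card_row; under eq_bigr do rewrite -e -sum1dep_card.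
rewrite -(partition_big T predT) //= sum1dep_card; apply: subset_leq_card.
apply/subsetP => p; rewrite !inE; case: ifP => // _.
by rewrite eq_sym s_neq.
Qed.

Lemma straighteningE A B (T : {ffun box lam -> 'I_n}) : contentD T = B ->
  straightening A B =
  #|[set Q : {set box lam} |
      (Q \subset [set p | ((brow p == s) && (T p < m)%N) || ((brow p == s1) && (m < T p)%N)])
      && (gmon (fun i k => #|[set p | ((if p \in Q then (if brow p == s then s1 else s)
             else (if (brow p == s1) && (T p <= m)%N then s else brow p)) == i)
             && (T p == k)]|) == gmon (shuffle_expo A))]|%:R.
Proof.
move=> <-; rewrite ffunE -prod_boxes.
rewrite (eq_bigr (fun p => x (if (brow p == s1) && (T p <= m)%N then s else brow p) (T p) +
   (if p \in [set p | ((brow p == s) && (T p < m)%N) || ((brow p == s1) && (m < T p)%N)]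
    then x (if brow p == s then s1 else s) (T p) else 0))); last first.
  by move=> p _; rewrite inE.
rewrite prod_add_cond raddf_sum /= -sum1dep_card natr_sum big_mkcondr /=.
apply: eq_bigr => Q _.
rewrite (eq_bigr (fun p => x (if p \in Q then (if brow p == s then s1 else s)
   else (if (brow p == s1) && (T p <= m)%N then s else brow p)) (T p))); last first.
  by move=> p _; case: ifP.
by rewrite prod_gen_word mcoeffX; case: eqP.
Qed.

End Straightening.

(** * Support and leading coefficient of a straightening relation *)

Section StraighteningCoefficients.
Variables (K : fieldType) (n : nat) (lam : 'I_n -> nat).
Implicit Types (A B : Dbasis n lam) (Q : {set box lam}).
Variables (s s1 m : 'I_n).
Hypothesis ss : s1 = s.+1 :> nat.

Let s_neq : (s == s1) = false.
Proof. by rewrite -val_eqE /= ss ltn_eqF. Qed.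
Let s_neq' : (s1 == s) = false.
Proof. by rewrite eq_sym. Qed.

Definition movable (T : {ffun box lam -> 'I_n}) : {set box lam} :=
  [set p | ((brow p == s) && (T p < m)%N) || ((brow p == s1) && (m < T p)%N)].

(** The row index of the variable taken at the box [p], where [Q] is the set of boxes at which the
    second summand of [shuffle_rows] is chosen. *)
Definition moved_row (T : {ffun box lam -> 'I_n}) Q (p : box lam) : 'I_n :=
  if p \in Q then (if brow p == s then s1 else s)
  else (if (brow p == s1) && (T p <= m)%N then s else brow p).

Variable T : {ffun box lam -> 'I_n}.

Lemma moved_row_other Q p i : Q \subset movable T -> i != s -> i != s1 ->
  (moved_row T Q p == i) = (brow p == i).
Proof.
move=> /subsetP QP is0 is1; rewrite /moved_row; case: ifP => [/QP|_].
  rewrite inE => /orP[]/andP[/eqP -> _]; rewrite ?eqxx ?s_neq'.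
    by rewrite ![_ == i]eq_sym (negbTE is0) (negbTE is1).
  by rewrite ![_ == i]eq_sym (negbTE is0) (negbTE is1).
case: ifP => // /andP[/eqP -> _].
by rewrite ![_ == i]eq_sym (negbTE is0) (negbTE is1).
Qed.

Lemma moved_row_both Q p : Q \subset movable T ->
  (moved_row T Q p == s) || (moved_row T Q p == s1) = (brow p == s) || (brow p == s1).
Proof.
move=> /subsetP QP; rewrite /moved_row; case: ifP => [/QP|_].
  by rewrite inE => /orP[]/andP[/eqP -> _]; rewrite ?eqxx ?s_neq' ?eqxx ?orbT.
by case: ifP => // /andP[/eqP -> _]; rewrite !eqxx orbT.
Qed.

Lemma moved_row_low Q p : Q \subset movable T -> (T p < m)%N ->
  (moved_row T Q p == s1) = (p \in Q).
Proof.
move=> /subsetP QP Tm; rewrite /moved_row; case: ifP => [/QP|_].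
  rewrite inE => /orP[]/andP[/eqP -> h]; rewrite ?eqxx //.
  by move: (ltn_trans h Tm); rewrite ltnn.
by rewrite (ltnW Tm) andbT; case: ifP => // _; rewrite s_neq.
Qed.

Lemma moved_row_mid Q p : Q \subset movable T -> T p = m ->
  (moved_row T Q p == s1) = false.
Proof.
move=> /subsetP QP Tm; rewrite /moved_row; case: ifP => [/QP|_].
  by rewrite inE Tm ltnn !andbF.
by rewrite Tm leqnn andbT; case: ifP => // _; rewrite s_neq.
Qed.

Lemma moved_row_high Q p : Q \subset movable T -> (m < T p)%N ->
  (moved_row T Q p == s1) = (p \notin Q) && (brow p == s1).
Proof.
move=> /subsetP QP Tm; rewrite /moved_row; case: ifP => [/QP|_] /=.
  rewrite inE => /orP[]/andP[/eqP -> h]; rewrite ?eqxx // ?s_neq' ?s_neq //.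
  by move: (ltn_trans h Tm); rewrite ltnn.
by rewrite leqNgt Tm andbF.
Qed.

Definition moved_count Q (i k : 'I_n) : nat :=
  #|[set p | (moved_row T Q p == i) && (T p == k)]|.

Let B := contentD T.

Lemma moved_count_other Q i k : Q \subset movable T -> i != s -> i != s1 ->
  moved_count Q i k = expo (B i) k.
Proof.
move=> QP is0 is1; rewrite expo_contentD; apply: eq_card => p.
by rewrite !inE moved_row_other.
Qed.

Lemma moved_count_both Q k : Q \subset movable T ->
  (moved_count Q s k + moved_count Q s1 k = expo (B s) k + expo (B s1) k)%N.
Proof.
move=> QP; rewrite !expo_contentD /moved_count.
have card2 (f : box lam -> 'I_n) :
    (#|[set p | (f p == s) && (T p == k)]| + #|[set p | (f p == s1) && (T p == k)]| =
     #|[set p | ((f p == s) || (f p == s1)) && (T p == k)]|)%N.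
  rewrite -cardsUI [X in (_ + X)%N](_ : _ = 0)%N ?addn0.
    by apply: eq_card => p; rewrite !inE andb_orl.
  apply: eq_card0 => p; rewrite !inE; case: eqP => //= ->.
  by rewrite s_neq andbF.
by rewrite !card2; apply: eq_card => p; rewrite !inE moved_row_both.
Qed.

Lemma moved_count_low Q (k : 'I_n) : Q \subset movable T -> (k < m)%N ->
  moved_count Q s1 k = #|[set p | (p \in Q) && (T p == k)]|.
Proof.
move=> QP km; apply: eq_card => p; rewrite !inE; case: (eqVneq (T p) k) => [Tk|]; last by rewrite !andbF.
by rewrite moved_row_low ?Tk.
Qed.

Lemma moved_count_mid Q : Q \subset movable T -> moved_count Q s1 m = 0%N.
Proof.
move=> QP; apply: eq_card0 => p; rewrite !inE; case: (eqVneq (T p) m) => [Tk|]; last by rewrite andbF.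
by rewrite moved_row_mid.
Qed.

Lemma moved_count_high Q (k : 'I_n) : Q \subset movable T -> (m < k)%N ->
  moved_count Q s1 k = #|[set p | [&& p \notin Q, brow p == s1 & T p == k]]|.
Proof.
move=> QP mk; apply: eq_card => p; rewrite !inE; case: (eqVneq (T p) k) => [Tk|]; last by rewrite !andbF.
by rewrite moved_row_high ?Tk // !andbT.
Qed.

Lemma shuffle_expo_both A k :
  (shuffle_expo s s1 m A s k + shuffle_expo s s1 m A s1 k =
   expo (A s) k + expo (A s1) k)%N.
Proof.
by rewrite /shuffle_expo eqxx s_neq' eqxx; case: (ltngtP k m); lia.
Qed.

Lemma straightening_count A :
  straightening K s s1 m A B =
  #|[set Q : {set box lam} | (Q \subset movable T) &&
      (gmon (moved_count Q) == gmon (shuffle_expo s s1 m A))]|%:R.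
Proof. by rewrite (straighteningE _ _ _ _ _ erefl). Qed.

(** Boxes taking a variable of row [s1] lie in row [s] if their letter is below [m], and in row [s1]
    if it is above; counting them gives the two inequalities. *)
Lemma straightening_supp A : straightening K s s1 m A B != 0 ->
  [/\ forall i k, i != s -> i != s1 -> expo (B i) k = expo (A i) k,
      forall k, (expo (B s) k + expo (B s1) k = expo (A s) k + expo (A s1) k)%N,
      forall k : 'I_n, (k < m)%N -> (expo (A s) k <= expo (B s) k)%N
    & forall k : 'I_n, (m < k)%N -> (expo (A s1) k <= expo (B s1) k)%N].
Proof.
rewrite straightening_count.
case: (set_0Vmem [set Q : {set box lam} | (Q \subset movable T) &&
      (gmon (moved_count Q) == gmon (shuffle_expo s s1 m A))]) => [->|[Q]].
  by rewrite cards0 eqxx.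
rewrite inE => /andP[QP /eqP/gmon_inj e] _; split=> [i k is0 is1|k|k km|k mk].
- by rewrite -(moved_count_other k QP is0 is1) e /shuffle_expo (negbTE is0) (negbTE is1).
- by rewrite -(moved_count_both k QP) !e shuffle_expo_both.
- have := e s1 k; rewrite (moved_count_low QP km) /shuffle_expo s_neq' eqxx km.
  rewrite ltnNge (ltnW km) addn0 => <-; rewrite expo_contentD; apply: subset_leq_card.
  apply/subsetP => p; rewrite !inE => /andP[pQ /eqP Tk]; rewrite Tk eqxx andbT.
  move/subsetP: QP => /(_ p pQ); rewrite inE Tk => /orP[/andP[]//|/andP[_ h]].
  by move: (ltn_trans h km); rewrite ltnn.
- have := e s1 k; rewrite (moved_count_high QP mk) /shuffle_expo s_neq' eqxx mk.
  rewrite ltnNge (ltnW mk) add0n => <-; rewrite expo_contentD; apply: subset_leq_card.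
  by apply/subsetP => p; rewrite !inE => /andP[_].
Qed.

(** The exponents force [Q] to contain all boxes of row [s] with a letter below [m] and no box of
    row [s1]. *)
Lemma straightening_diag : straightening K s s1 m B B = 1.
Proof.
rewrite straightening_count.
pose Q0 : {set box lam} := [set p | (brow p == s) && (T p < m)%N].
have Q0P : Q0 \subset movable T by apply/subsetP => p; rewrite !inE => ->.
suff -> : [set Q : {set box lam} | (Q \subset movable T) &&
      (gmon (moved_count Q) == gmon (shuffle_expo s s1 m B))] = [set Q0] by rewrite cards1.
have low (k : 'I_n) : (k < m)%N -> shuffle_expo s s1 m B s1 k = expo (B s) k.
  by move=> km; rewrite /shuffle_expo s_neq' eqxx km ltnNge (ltnW km) addn0.
have high (k : 'I_n) : (m < k)%N -> shuffle_expo s s1 m B s1 k = expo (B s1) k.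
  by move=> km; rewrite /shuffle_expo s_neq' eqxx km ltnNge (ltnW km).
apply/setP => Q; rewrite !inE; apply/andP/eqP => [[QP /eqP/gmon_inj e]|->].
  apply/setP => p; rewrite inE; apply/idP/andP => [pQ|[ps pm]].
    move/subsetP: (QP) => /(_ p pQ); rewrite inE => /orP[/andP[]//|/andP[p1 pm]].
    have := e s1 (T p); rewrite (moved_count_high QP pm) high // expo_contentD => h.
    suff hs : [set p0 | [&& p0 \notin Q, brow p0 == s1 & T p0 == T p]] \subset
       [set p0 | (brow p0 == s1) && (T p0 == T p)].
      have /eqP/setP/(_ p) : [set p0 | [&& p0 \notin Q, brow p0 == s1 & T p0 == T p]] ==
       [set p0 | (brow p0 == s1) && (T p0 == T p)] by rewrite eqEcard hs h leqnn.
      by rewrite !inE pQ p1 eqxx.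
    by apply/subsetP => q; rewrite !inE => /andP[].
  have := e s1 (T p); rewrite (moved_count_low QP pm) low // expo_contentD => h.
  have hs : [set p0 | (p0 \in Q) && (T p0 == T p)] \subset
       [set p0 | (brow p0 == s) && (T p0 == T p)].
    apply/subsetP => q; rewrite !inE => /andP[qQ /eqP Tq]; rewrite Tq eqxx andbT.
    move/subsetP: QP => /(_ q qQ); rewrite inE Tq => /orP[/andP[]//|/andP[_ h']].
    by move: (ltn_trans h' pm); rewrite ltnn.
  have /eqP/setP/(_ p) : [set p0 | (p0 \in Q) && (T p0 == T p)] ==
     [set p0 | (brow p0 == s) && (T p0 == T p)] by rewrite eqEcard hs h leqnn.
  by rewrite !inE ps eqxx !andbT.
split=> //; apply/eqP/eq_gmon => i k.
have e1 : moved_count Q0 s1 k = shuffle_expo s s1 m B s1 k.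
  case: (ltngtP k m) => [km|mk|/val_inj ->].
  - rewrite moved_count_low // low // expo_contentD; apply: eq_card => p.
    by rewrite !inE; case: (eqVneq (T p) k) => [->|]; rewrite ?andbF // km !andbT.
  - rewrite moved_count_high // high // expo_contentD; apply: eq_card => p.
    rewrite !inE; case: (eqVneq (T p) k) => [->|]; rewrite ?andbF // !andbT.
    by rewrite ltnNge (ltnW mk) andbF.
  by rewrite moved_count_mid // /shuffle_expo s_neq' eqxx ltnn.
case: (eqVneq i s1) => [->|is1] //.
case: (eqVneq i s) => [->|is0].
  by apply/eqP; rewrite -(eqn_add2r (moved_count Q0 s1 k)) moved_count_both // e1
    shuffle_expo_both.
by rewrite moved_count_other // /shuffle_expo (negbTE is0) (negbTE is1).
Qed.

End StraighteningCoefficients.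

(** * Triangularity with respect to the statistic *)

Section Triangularity.
Variables (K : fieldType) (n : nat) (lam : 'I_n -> nat).
Implicit Types (A B : Dbasis n lam).
Variables (s s1 m : 'I_n).
Hypothesis ss : s1 = s.+1 :> nat.

Lemma straightening1 A : straightening K s s1 m A A = 1.
Proof. by rewrite -(contentD_sorted A); apply: straightening_diag. Qed.

(** Since [s1] is [s] plus one, the statistic is determined by row [s1] and by sums that agree for
    [A] and [B]. Row [s1] can only lose letters below [m] and gain letters above [m]. *)
Lemma straightening_gt A B : straightening K s s1 m A B != 0 ->
  B = A \/ (statistic A < statistic B)%N.
Proof.
have s_neq : (s == s1) = false by rewrite -val_eqE /= ss ltn_eqF.
rewrite -{1}(contentD_sorted B) => /(straightening_supp ss).
rewrite contentD_sorted => -[h0 h1 h2 h3].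
have [/forallP hk|] := boolP [forall k : 'I_n, (k != m) ==> (expo (B s1) k == expo (A s1) k)].
  left; have e1 k : expo (B s1) k = expo (A s1) k.
    case: (eqVneq k m) => [->|ne]; last by apply/eqP; move: (hk k); rewrite ne.
    have : (\sum_k expo (B s1) k = \sum_k expo (A s1) k)%N by rewrite !sum_expo.
    rewrite (bigD1 m) //= [in RHS](bigD1 m) //=.
    rewrite (eq_bigr (fun k : 'I_n => expo (A s1) k)); last first.
      by move=> j ne; apply/eqP; move: (hk j); rewrite ne.
    by move/eqP; rewrite eqn_add2r => /eqP.
  apply: Dbasis_inj => i k.
  case: (eqVneq i s1) => [->|is1] //; case: (eqVneq i s) => [->|is0]; last exact: h0.
  by apply/eqP; rewrite -(eqn_add2r (expo (B s1) k)) h1 e1.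
rewrite negb_forall => /existsP[k0]; rewrite negb_imply => /andP[k0m k0n].
right.
(* Without subtraction, this says that k - m times the gain of row [s1] at the letter k is
   nonnegative, and at least 1 for k = [k0]. In the sum over k the multiples of m cancel. *)
have term (k : 'I_n) : (k * expo (A s1) k + m * expo (B s1) k + ((k == k0) : nat) <=
               k * expo (B s1) k + m * expo (A s1) k)%N.
  have hk0 : k = k0 -> k != m /\ expo (B s1) k != expo (A s1) k by move=> ->.
  have := h1 k; have := h2 k; have := h3 k.
  case: (ltngtP k m) => [km|mk|/val_inj e] h3' h2' h1'.
  - have {}h2' := h2' isT.
    have le : (expo (B s1) k <= expo (A s1) k)%N by lia.
    case: (eqVneq k k0) => [/hk0[_ ne]|_]; nia.
  - have le := h3' isT.
    case: (eqVneq k k0) => [/hk0[_ ne]|_]; nia.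
  - case: (eqVneq k k0) => [/hk0[]|_]; first by rewrite e eqxx.
    by rewrite e addn0 addnC.
have tot : (\sum_(k < n) k * expo (A s1) k < \sum_(k < n) k * expo (B s1) k)%N.
  have : (\sum_(k < n) (k * expo (A s1) k + m * expo (B s1) k + ((k == k0) : nat)) <=
     \sum_(k < n) (k * expo (B s1) k + m * expo (A s1) k))%N by apply: leq_sum => k _.
  rewrite !big_split /= -!big_distrr /= !sum_expo.
  have -> : (\sum_(k < n) ((k == k0) : nat) = 1)%N.
    by rewrite (bigD1 k0) //= eqxx big1 // => k /negbTE->.
  lia.
have col (C : Dbasis n lam) : statistic C = (\sum_(i < n | (i != s) && (i != s1)) \sum_(k < n) i * k * expo (C i) k
    + s * (\sum_(k < n) k * (expo (C s) k + expo (C s1) k)) + \sum_(k < n) k * expo (C s1) k)%N.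
  rewrite /statistic (bigD1 s) //= [X in (_ + X)%N](bigD1 s1) /=; last by rewrite eq_sym s_neq.
  rewrite addnA addnC -addnA; congr (_ + _)%N; rewrite big_distrr -!big_split /=.
  by apply: eq_bigr => k _; rewrite ss; lia.
rewrite !col.
rewrite (eq_bigr (fun i : 'I_n => \sum_(k < n) i * k * expo (B i) k)%N); last first.
  by move=> i /andP[i0 i1]; apply: eq_bigr => k _; rewrite h0.
rewrite [X in (_ + s * X + _ < _)%N](eq_bigr (fun k : 'I_n => k * (expo (B s) k + expo (B s1) k))%N).
  by rewrite ltn_add2l.
by move=> k _; rewrite h1.
Qed.

End Triangularity.

(** * The kernel of the projection onto the Weyl module *)

Section ColumnSets.
Variables (n m : nat) (b : 'I_m -> nat).
Notation box := (box b).
Notation filling := {ffun box -> 'I_n}.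
Implicit Types (T U : filling).

Lemma has_columns_ex T :
  (forall p q, bcol p = bcol q -> T p = T q -> p = q) ->
  exists S : ext_basis n b, has_columns S T.
Proof.
move=> inj.
pose S := [ffun c : 'I_(ncols b) => [set T p | p in [set p | bcol p == c :> nat]]].
have SP : [forall c, #|S c| == conj_part b c].
  apply/forallP => c; rewrite ffunE card_in_imset ?card_column // => p q.
  by rewrite !inE => /eqP pc /eqP qc; apply: inj; rewrite pc qc.
exists (exist (fun S : {ffun 'I_(ncols b) -> {set 'I_n}} =>
  [forall c, #|S c| == conj_part b c]) S SP).
by apply/forallP => c; rewrite /= ffunE.
Qed.

Definition column_strict T :=
  [forall p, forall q, (bcol p == bcol q) && (brow p < brow q)%N ==> (T p < T q)%N].

Lemma column_strictP T :
  reflect (forall p q, bcol p = bcol q -> (brow p < brow q)%N -> (T p < T q)%N)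
          (column_strict T).
Proof.
apply: (iffP forallP) => h p; last first.
  by apply/forallP => q; apply/implyP => /andP[/eqP]; apply: h.
by move=> q pq rpq; move/forallP: (h p) => /(_ q); rewrite pq eqxx rpq.
Qed.

Lemma column_strict_inj T p q : column_strict T -> bcol p = bcol q -> T p = T q -> p = q.
Proof.
move=> /column_strictP h pq Tpq; apply: box_inj => //; apply: val_inj; apply/eqP.
case: (ltngtP (brow p) (brow q)) => // r; first by have := h _ _ pq r; rewrite Tpq ltnn.
by have := h _ _ (esym pq) r; rewrite Tpq ltnn.
Qed.

(** In a column-strict filling the entry at [p] exceeds exactly the entries above it. The number of
    entries of a column below a given letter depends on [S] alone, so a smaller entry of [U] at [p]
    would make one too many. *)
Lemma column_strict_leq S T U : column_strict T -> column_strict U ->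
  has_columns S T -> has_columns S U -> forall p, (T p <= U p)%N.
Proof.
move=> Ts Us TS US p; rewrite leqNgt; apply/negP => UT.
have count V : has_columns S V -> forall k : 'I_n,
    #|[set q | (bcol q == bcol p) && (V q < k)%N]| =
    #|[set i in val S (Ordinal (bcol_ltn p)) | (i < k)%N]|.
  move=> VS k; rewrite -(@card_in_imset _ _ V) => [|q r]; last first.
    rewrite !inE => /andP[/eqP qp _] /andP[/eqP rp _].
    by apply: (has_columns_inj VS); rewrite qp rp.
  move/forallP: (VS) => /(_ (Ordinal (bcol_ltn p)))/eqP ->.
  apply: eq_card => i; rewrite inE; apply/imsetP/andP => [[q]|[/imsetP[q]]].
    by rewrite inE => /andP[qp qk] ->; split=> //; apply/imsetP; exists q; rewrite ?inE.
  by rewrite inE => qp -> qk; exists q; rewrite // inE qp.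
have rank V : column_strict V -> [set q | (bcol q == bcol p) && (V q < V p)%N] =
    [set q | (bcol q == bcol p) && (brow q < brow p)%N].
  move=> /column_strictP Vs; apply/setP => q; rewrite !inE; case: eqP => //= qp.
  apply/idP/idP => [|h]; last exact: Vs.
  apply: contraLR; rewrite -!leqNgt leq_eqVlt => /orP[/eqP/val_inj e|h].
    by rewrite (box_inj (esym e) qp).
  by apply: ltnW; apply: Vs.
have := count T TS (T p); rewrite -(count U US) rank // => e.
have : [set q | (bcol q == bcol p) && (brow q < brow p)%N] \proper
       [set q | (bcol q == bcol p) && (U q < T p)%N].
  apply/properP; split.
    apply/subsetP => q; rewrite -(rank U Us) !inE => /andP[-> h] /=.
    exact: ltn_trans h UT.
  by exists p; rewrite !inE eqxx //= ltnn.
by move/proper_card; rewrite e ltnn.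
Qed.

Lemma column_strict_unique S T U : column_strict T -> column_strict U ->
  has_columns S T -> has_columns S U -> T = U.
Proof.
move=> Ts Us TS US; apply/ffunP => p; apply/val_inj/eqP => /=.
by rewrite eqn_leq !(@column_strict_leq S).
Qed.

Definition filling_statistic T := (\sum_p brow p * T p)%N.

(** Exchanging two entries of a column in the wrong order puts the larger one into the row of larger
    index. *)
Lemma filling_statistic_swap S T : has_columns S T -> ~~ column_strict T ->
  exists2 U, has_columns S U & (filling_statistic T < filling_statistic U)%N.
Proof.
move=> TS; rewrite negb_forall => /existsP[p]; rewrite negb_forall => /existsP[q].
rewrite negb_imply -leqNgt => /andP[/andP[/eqP pq rpq] Tpq].
exists [ffun x => T (tperm p q x)]; first by rewrite has_columns_tperm.
have npq : q != p by apply: contraTneq rpq => ->; rewrite ltnn.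
have {}Tpq : (T q < T p)%N.
  rewrite ltn_neqAle Tpq andbT; apply: contraNneq npq => /val_inj e.
  by rewrite (has_columns_inj TS pq (esym e)).
have split U : filling_statistic U = (brow p * U p + brow q * U q +
    \sum_(x | (x != p) && (x != q)) brow x * U x)%N.
  by rewrite /filling_statistic (bigD1 p) //= (bigD1 q) //= addnA.
rewrite !split !ffunE tpermL tpermR.
rewrite [X in (_ < _ + X)%N](eq_bigr (fun x => brow x * T x)%N); last first.
  by move=> x /andP[xp xq]; rewrite ffunE tpermD // eq_sym.
rewrite ltn_add2r; move: (nat_of_ord (T p)) (nat_of_ord (T q)) Tpq => tp tq.
move: rpq; move: (nat_of_ord (brow p)) (nat_of_ord (brow q)) => i j; nia.
Qed.

(** A filling maximizing the statistic for the column sets [S] is column strict by the preceding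
    exchange, and there is only one column-strict filling. *)
Lemma filling_statistic_max S T U : column_strict T -> has_columns S T ->
  has_columns S U -> U != T -> (filling_statistic U < filling_statistic T)%N.
Proof.
move=> Ts TS.
have le V : has_columns S V -> (filling_statistic V <= filling_statistic T)%N.
  move=> VS.
  have [W WS Wmax] := @arg_maxnP _ V (fun W => has_columns S W) filling_statistic VS.
  apply: leq_trans (Wmax V VS) _; case: (boolP (column_strict W)) => Ws.
    by rewrite (column_strict_unique Ws Ts WS TS).
  have [W' W'S lt] := filling_statistic_swap WS Ws.
  by move: (leq_trans lt (Wmax W' W'S)); rewrite ltnn.
move=> US UT; case: (boolP (column_strict U)) => Us.
  by case/eqP: UT; apply: column_strict_unique US TS.
by have [V VS lt] := filling_statistic_swap US Us; apply: leq_trans lt (le V VS).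
Qed.

End ColumnSets.

(** * Leading terms of elements of the kernel *)

Section WeylKernel.
Variables (K : fieldType) (charK : 2%N \in [pchar K]) (n : nat) (lam : 'I_n -> nat).
Hypothesis lam_part : forall i j : 'I_n, (i <= j)%N -> (lam j <= lam i)%N.
Implicit Types (A B : Dbasis n lam).
Notation io := (@mpolyC #|{: 'I_n * 'I_n}| K).

Lemma statistic_contentD (T : {ffun box lam -> 'I_n}) :
  statistic (contentD T) = filling_statistic T.
Proof.
rewrite /statistic /filling_statistic (partition_big (@brow _ lam) predT) //=.
apply: eq_bigr => i _; rewrite (partition_big T predT) //=; apply: eq_bigr => k _.
rewrite expo_contentD mulnC -sum_nat_const; apply: eq_big => [p|p]; rewrite inE //.
by case/andP => /eqP -> /eqP ->.
Qed.

(* The tableau of shape lam with row contents A is semistandard. *)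
Definition semistandard_content A :=
  [forall s : 'I_n, forall s1 : 'I_n, forall m : 'I_n, (s1 == s.+1 :> nat) ==>
     (psum (expo (A s1)) m.+1 <= psum (expo (A s)) m)%N].

(** The condition on adjacent rows chains along the rows in between. At the letter of [q] it says
    that the column of [q] lies in the part of the row of [p] with smaller letters. *)
Lemma semistandard_content_strict A :
  semistandard_content A -> column_strict (sorted_filling (sum_expo A)).
Proof.
move=> /forallP h.
have adj (s s1 : 'I_n) (m : 'I_n) : s1 = s.+1 :> nat ->
    (psum (expo (A s1)) m.+1 <= psum (expo (A s)) m)%N.
  by move=> e; move/forallP: (h s) => /(_ s1)/forallP/(_ m); rewrite e eqxx.
have gap d (i j : 'I_n) (m : 'I_n) : j = (i + d.+1)%N :> nat ->
    (psum (expo (A j)) m.+1 <= psum (expo (A i)) m)%N.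
  elim: d i => [|d IH] i e; first by apply: adj; rewrite e addn1.
  have i1 : (i.+1 < n)%N by apply: leq_ltn_trans (ltn_ord j); rewrite e; lia.
  apply: leq_trans (adj i (Ordinal i1) m erefl).
  apply: leq_trans (IH (Ordinal i1) _) _; first by rewrite e /=; lia.
  exact/leq_psum.
apply/column_strictP => p q pq rpq.
rewrite sorted_filling_ltn pq.
apply: (@leq_trans (psum (expo (A (brow q))) (sorted_filling (sum_expo A) q).+1)).
  by rewrite -(sorted_filling_ltn (sum_expo A)).
by apply: (gap (brow q - brow p).-1); lia.
Qed.

(** At the column sets of the tableau with content [A], the coordinate of the image is the sum of
    the coefficients of [x] over all fillings with these column sets. Those other than the tableau
    have smaller statistic, where [x] vanishes. *)
Lemma dprime_min_coef (x : D K n lam) A :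
  dprime K n lam x = 0 -> semistandard_content A ->
  (forall B, x B != 0 -> (statistic A <= statistic B)%N) -> x A = 0.
Proof.
move=> x0 Ass xmin; set T := sorted_filling (sum_expo A).
have Ts : column_strict T by apply: semistandard_content_strict.
have [|S TS] := @has_columns_ex _ _ _ T.
  by move=> p q; apply: column_strict_inj.
have := ext_dprime idfun charK x S; rewrite ext_id x0 ffunE (bigD1 T) //=.
rewrite contentD_sorted big1 ?addr0 // => U /andP[US UT].
apply/eqP/negPn/negP => /xmin; rewrite statistic_contentD leqNgt.
rewrite -{1}(contentD_sorted A) statistic_contentD.
by rewrite (filling_statistic_max Ts TS US UT).
Qed.

(* Straightening: the relations with a given least term are subtracted from an
   element of the kernel in order of increasing statistic. *)
Lemma ker_dprime_sub (C : finType) (f : 'Hom(D K n lam, free K C)) :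
  (forall (s s1 : 'I_n) v b, s1 = s.+1 :> nat ->
     ext io f (@dpow _ _ _ lam (shear s s1 1 v)) b = ext io f (@dpow _ _ _ lam v) b) ->
  (lker (dprime K n lam) <= lker f)%VS.
Proof.
have charP : 2%N \in [pchar {mpoly K[#|{: 'I_n * 'I_n}|]}] by apply: (rmorph_pchar io).
move=> finv.
have dinv (s s1 : 'I_n) v S : s1 = s.+1 :> nat ->
    ext io (dprime K n lam) (@dpow _ _ _ lam (shear s s1 1 v)) S =
    ext io (dprime K n lam) (@dpow _ _ _ lam v) S.
  move=> ss; rewrite !ext_dprime_dpow //.
  (* For [q] in row [s1], [g q] is the box above it in row [s], which exists because [lam] is a
     partition. *)
  pose g (p : box lam) : box lam :=
    if insub (bcol p) is Some c then Tagged (fun i => 'I_(lam i)) (c : 'I_(lam s)) else p.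
  have gE (q : box lam) : brow q = s1 -> brow (g q) = s /\ bcol (g q) = bcol q.
    move=> qs; have h : (bcol q < lam s)%N.
      apply: leq_trans (lam_part (i := s) (j := s1) _); last by rewrite ss.
      by rewrite -qs /bcol; case: q {qs} => i [].
    by rewrite /g insubT.
  apply: (colform_shear charP _ (g := g) (u := fun=> 1) (Q := [set p | brow p == s1])).
  - move=> q; rewrite inE => /eqP /gE[gs gc]; split=> //.
    by rewrite inE gs -val_eqE /= ss ltn_eqF.
  - by move=> q k; rewrite inE => /eqP qs; rewrite /shear qs eqxx (gE q qs).1.
  - by move=> q k; rewrite inE => /negbTE qs; rewrite /shear qs addr0.
have rel A : exists rho : D K n lam, ~~ semistandard_content A ->
    [/\ f rho = 0, dprime K n lam rho = 0, rho A = 1 &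
        forall B, rho B != 0 -> B = A \/ (statistic A < statistic B)%N].
  case: (boolP (semistandard_content A)) => [_|]; first by exists 0.
  rewrite negb_forall => /existsP[s]; rewrite negb_forall => /existsP[s1].
  rewrite negb_forall => /existsP[m]; rewrite negb_imply -ltnNge => /andP[/eqP ss viol].
  exists (straightening K s s1 m A) => _; split.
  - by apply: straightening_ker => // v b; apply: finv.
  - by apply: straightening_ker => // v b; apply: dinv.
  - exact: straightening1.
  - by move=> B; apply: straightening_gt.
have [rho rhoP] := fin_all_exists rel.
pose W := (\max_(B : Dbasis n lam) statistic B).+1.
(* Descending induction on a lower bound [N] for the statistics in the support of [x]; [W] exceeds
   every statistic. *)
suff main k N x : (N + k = W)%N -> dprime K n lam x = 0 ->
    (forall B, x B != 0 -> (N <= statistic B)%N) -> f x = 0.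
  apply/subvP => x; rewrite !memv_ker => /eqP x0; apply/eqP.
  exact: (main W 0%N).
elim: k N x => [|k IH] N x NW x0 xN.
  suff -> : x = 0 by rewrite linear0.
  apply/ffunP => B; rewrite ffunE; apply/eqP/negPn/negP => /xN.
  by rewrite -(addn0 N) NW leqNgt ltnS leq_bigmax.
pose low A := (statistic A == N) && (x A != 0).
have lowP A : low A -> ~~ semistandard_content A.
  case/andP => /eqP AN xA; apply: contraNN xA => Ass; apply/eqP.
  by apply: dprime_min_coef => // B /xN; rewrite AN.
(* Subtracting these relations removes the terms of statistic [N] and adds only terms of larger
   statistic. *)
pose y := x - \sum_(A | low A) x A *: rho A.
have -> : f x = f y.
  rewrite linearB linear_sum big1 ?subr0 // => A /lowP/rhoP[fr _ _ _].
  by rewrite linearZ /= fr scaler0.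
apply: (IH N.+1); first by rewrite -NW addSnnS.
  rewrite linearB /= x0 linear_sum big1 ?subr0 // => A /lowP/rhoP[_ dr _ _].
  by rewrite linearZ /= dr scaler0.
move=> B yB; rewrite ltn_neqAle.
have yE : y B = x B - \sum_(A | low A) x A * rho A B.
  by rewrite !ffunE sum_ffunE; congr (_ - _); apply: eq_bigr => A _; rewrite ffunE.
have rho_le A : low A -> rho A B != 0 -> B = A \/ (N < statistic B)%N.
  by move=> lA; have [_ _ _ h] := rhoP A (lowP A lA); case/andP: lA => /eqP <- _; apply: h.
apply/andP; split.
  apply: contraNneq yB => NB; rewrite yE.
  case: (boolP (low B)) => lB.
    rewrite (bigD1 B) //= big1 ?addr0.
      by have [_ _ -> _] := rhoP B (lowP B lB); rewrite mulr1 subrr.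
    move=> A /andP[lA AB]; case: (eqVneq (rho A B) 0) => [->|/rho_le]; first by rewrite mulr0.
    case/(_ lA) => [BA|]; first by rewrite BA eqxx in AB.
    by rewrite -NB ltnn.
  have -> : x B = 0 by apply/eqP; move: lB; rewrite /low -NB eqxx negbK.
  rewrite big1 ?subr0 // => A lA.
  case: (eqVneq (rho A B) 0) => [->|/rho_le]; first by rewrite mulr0.
  case/(_ lA) => [BA|]; first by rewrite BA lA in lB.
  by rewrite -NB ltnn.
rewrite leqNgt; apply/negP => BN; case/negP: yB; rewrite yE.
have -> : x B = 0 by apply/eqP/negPn/negP => /xN; rewrite leqNgt BN.
rewrite big1 ?subr0 // => A lA.
case: (eqVneq (rho A B) 0) => [->|/rho_le]; first by rewrite mulr0.
case/(_ lA) => [BA|h]; last by move: (ltn_trans BN h); rewrite ltnn.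
by case/andP: lA => /eqP AN; move: BN; rewrite BA AN ltnn.
Qed.

End WeylKernel.

(** * Binary arithmetic *)

Section Binary.
Local Open Scope nat_scope.

Lemma dvdn_pow2_even e t c : 2 ^ e %| t * c -> 0 < t < 2 ^ e -> ~~ odd c.
Proof.
move=> h /andP[t0 te]; apply/negP => oc.
have cop : coprime (2 ^ e) c by rewrite coprimeXl // coprime2n.
rewrite Gauss_dvdl // in h.
by move: (dvdn_leq t0 h); rewrite leqNgt te.
Qed.

Lemma even_bin_pow2 e N t : 2 ^ e %| N -> 0 < t < 2 ^ e -> ~~ odd 'C(N, t).
Proof.
move=> eN te; apply: dvdn_pow2_even te.
case: t => [|t]; first by rewrite mul0n dvdn0.
case: N eN => [|N] eN; first by rewrite bin0n muln0 dvdn0.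
by rewrite -mul_bin_diag dvdn_mulr.
Qed.

(** By Pascal's rule, the even entries of row N + 1 make neighbouring entries of row N have the same
    parity. *)
Lemma odd_bin_pow2_pred e N j : 2 ^ e %| N.+1 -> j < 2 ^ e -> odd 'C(N, j).
Proof.
move=> eN; elim: j => [|j IH] je; first by rewrite bin0.
have := @even_bin_pow2 e N.+1 j.+1 eN je; rewrite binS oddD IH ?(ltnW je) //.
by rewrite addbT negbK.
Qed.

Lemma l2_leq y i : (l2 y <= i) = (y < 2 ^ i).
Proof.
rewrite /l2; case: ex_minnP => l yl lmin; apply/idP/idP => [li|/lmin //].
by apply: leq_trans yl _; rewrite leq_exp2l.
Qed.

(** The number 2^e is the exact power of 2 dividing g + 1. *)
Lemma pow2_l2_obstruction y g : ~~ (2 ^ l2 y %| g + 1) ->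
  exists e q, [/\ 2 ^ e <= y, g + 1 = q * 2 ^ e & odd q].
Proof.
move=> h; have g0 : 0 < g + 1 by rewrite addn1.
have [q cq gq] := @pfactor_coprime 2 (g + 1) isT g0.
exists (logn 2 (g + 1)), q; split=> //; last by rewrite coprime2n in cq.
rewrite leqNgt -l2_leq; apply: contra h => h.
by rewrite pfactor_dvdn.
Qed.

(** Both directions use t 'C(g + t, t) = (g + 1) 'C(g + t, t - 1). Under the divisibility, t has too
    few factors 2 for 'C(g + t, t) to be odd. Otherwise take for t the exact power of 2 in g + 1:
    cancelling it leaves a product of odd numbers. *)
Lemma even_bins_l2 g y :
  (forall t, 0 < t <= y -> ~~ odd 'C(g + t, t)) <-> 2 ^ l2 y %| g + 1.
Proof.
split=> [h|h t /andP[t0 ty]].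
  apply/negPn/negP => /pow2_l2_obstruction[e [q [ey gq oq]]].
  have e0 : 0 < 2 ^ e by rewrite expn_gt0.
  have /negP := h (2 ^ e) (introT andP (conj e0 ey)); apply.
  have := @mul_bin_left (g + 2 ^ e) (2 ^ e).-1.
  rewrite prednK // (_ : g + 2 ^ e - (2 ^ e).-1 = q * 2 ^ e) => [|]; last by lia.
  rewrite (mulnC q) -mulnA => /eqP; rewrite eqn_pmul2l // => /eqP ->.
  rewrite oddM oq (@odd_bin_pow2_pred e) //; last by rewrite prednK.
  rewrite -addSn -[g.+1]addn1 gq -[X in _ + X]mul1n -mulnDl.
  exact: dvdn_mull.
apply: (@dvdn_pow2_even (l2 y) t); last by rewrite t0 (leq_ltn_trans ty) // -l2_leq.
case: t t0 {ty} => // t _.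
rewrite mul_bin_left (_ : g + t.+1 - t = g + 1); last by lia.
exact: dvdn_mulr.
Qed.

Lemma binary_expansion c : exists (t : nat -> bool) L, c = \sum_(0 <= i < L) t i * 2 ^ i.
Proof.
have [L] := ubnP c; elim: L c => // L IH c cL.
case: (posnP c) => [->|c0].
  by exists (fun=> false), 0; rewrite big_geq.
have [|t [M e]] := IH c./2; first by rewrite -divn2; lia.
exists (fun i => if i is i'.+1 then t i' else odd c), M.+1.
rewrite big_nat_recl //= muln1 -[LHS]odd_double_half e -muln2 big_distrl /=; congr (_ + _).
by apply: eq_bigr => i _; rewrite expnS mulnAC mulnA.
Qed.

Lemma sum_pow2 m : (\sum_(0 <= j < m) 2 ^ j).+1 = 2 ^ m.
Proof.
elim: m => [|m IH]; first by rewrite big_geq.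
by rewrite big_nat_recr //= -addSn IH expnS mul2n addnn.
Qed.

Lemma sum_bits_ltn (d : nat -> bool) m : \sum_(0 <= j < m) d j * 2 ^ j < 2 ^ m.
Proof.
rewrite -sum_pow2 ltnS; apply: leq_sum => i _.
by case: (d i); rewrite ?mul1n ?mul0n.
Qed.

(** Adding 1 to the block of ones up to position m gives 2^(m+1), which also divides the part formed
    by the higher digits. *)
Lemma two_complement_dvdn j k : 0 < j -> two_complement j k ->
  exists m, [/\ 2 ^ m <= j, j < 2 ^ m.+1 & 2 ^ m.+1 %| j + k + 1].
Proof.
rewrite /two_complement lt0n => /negbTE -> [m [d [M [t [dm jE jkE]]]]].
exists m; split.
- by rewrite jE big_nat_recr //= dm mul1n leq_addl.
- by rewrite jE sum_bits_ltn.
rewrite jkE -addnA addn1 sum_pow2 dvdn_addl // big_nat_cond.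
apply: (big_ind (dvdn (2 ^ m.+1))) => [//|x y|i /andP[/andP[mi _] _]]; first exact: dvdn_add.
by apply: dvdn_mull; apply: dvdn_exp2l.
Qed.

Lemma two_complement_pow2 e k : 2 ^ e.+1 %| 2 ^ e + k + 1 -> two_complement (2 ^ e) k.
Proof.
move=> /dvdnP[c cE]; rewrite /two_complement expn_eq0 /=.
have c0 : 0 < c by rewrite lt0n; apply/eqP => c0; move: cE; rewrite c0; lia.
have [t [L ct]] := binary_expansion c.-1.
(* The sum 2^e + k is c 2^(e+1) - 1: ones up to position e, and above them the digits of c - 1. *)
exists e, (fun i => i == e), (e.+1 + L), (fun i => t (i - e.+1)); split=> //.
  rewrite big_nat_recr //= eqxx mul1n big_nat_cond big1 // => i /andP[/andP[_ ie] _].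
  by rewrite (ltn_eqF ie).
apply/eqP; rewrite -(eqn_add2r 1) cE -addnA [X in _ + X]addn1 sum_pow2.
rewrite -[X in index_iota X _]add0n big_addn addKn.
rewrite (eq_bigr (fun i => t i * 2 ^ i * 2 ^ e.+1)) => [|i _]; last first.
  by rewrite addnK expnD mulnA.
by rewrite -big_distrl /= -ct -mulSnr prednK.
Qed.

(** If the divisibility fails, the exact power of 2 in g + 1 is a positive j at most y with
    2-complement g. If it holds, a positive j at most y with 2-complement g would be divisible by a
    power of 2 exceeding it. *)
Lemma max_two_complement0 y g : 2 <= y ->
  max_two_complement y g 0 <-> 2 ^ l2 y %| g + 1.
Proof.
move=> y2; split=> [[_ _ h]|h].
  apply/negPn/negP => /pow2_l2_obstruction[e [q [ey gq oq]]].
  have := h (2 ^ e) ey; rewrite leqn0 expn_eq0 /= => H.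
  suff : false by []. apply: H.
  apply: two_complement_pow2; rewrite -addnA gq -[X in X + _]mul1n -mulnDl expnS.
  by apply: dvdn_mul => //; rewrite dvdn2 oddD oq.
split=> //.
  rewrite /two_complement /=.
  have : 2 %| g + 1.
    apply: dvdn_trans h; rewrite -{1}(expn1 2); apply: dvdn_exp2l.
    by rewrite ltnNge l2_leq -ltnNge expn0; lia.
  by rewrite dvdn2 addn1 /= negbK.
move=> j jy; case: (posnP j) => [->//|j0] /(two_complement_dvdn j0)[m [mj jm dv]].
exfalso; have ml : m.+1 <= l2 y.
  by rewrite ltnNge l2_leq -leqNgt; apply: leq_trans jy.
have := dvdn_trans (dvdn_exp2l 2 ml) h => h'.
move: dv; rewrite -addnA dvdn_addl // => /(dvdn_leq j0).
by rewrite leqNgt jm.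
Qed.

End Binary.

(** * Conclusion *)

Section SquareKernel.
Variables (K : fieldType) (n : nat) (lam : 'I_n -> nat) (B : finType).

Lemma square_delta (x : sq_index lam) (A : Dbasis n (sq_wt x)) :
  square K lam (delta K (Tagged (fun x => Dbasis n (sq_wt x)) A)) =
  sq_component K x (delta K A).
Proof.
rewrite lfunE /= /square_fun (bigD1 x) //= big1 ?addr0 => [|y yx].
  congr (sq_component K x _); apply/ffunP => A'; rewrite !ffunE.
  by rewrite eq_Tagged.
suff -> : sq_proj y (delta K (Tagged (fun x => Dbasis n (sq_wt x)) A)) = 0.
  by rewrite linear0.
apply/ffunP => A'; rewrite !ffunE; case: eqP => // /(congr1 tag) /= e.
by rewrite e eqxx in yx.
Qed.

Lemma limg_square_sub (f : 'Hom(D K n lam, free K B)) :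
  (limg (square K lam) <= lker f)%VS <->
  forall x, (f \o sq_component K x)%VF = 0.
Proof.
split=> [/subvP h x|h].
  apply/lfunP => v; rewrite [RHS]lfunE /= comp_lfunE (free_delta v) !linear_sum big1 // => A _.
  rewrite !linearZ /= -square_delta (_ : f _ = 0) ?scaler0 //.
  by apply/eqP; rewrite -memv_ker h // memv_img ?memvf.
apply/subvP => _ /memv_imgP[v _ ->]; rewrite memv_ker lfunE /= /square_fun.
rewrite linear_sum /= big1 // => x _.
by move/lfunP/(_ (sq_proj x v)): (h x); rewrite comp_lfunE => ->; rewrite lfunE.
Qed.

End SquareKernel.

(** * Existence and separation of the fillings of first kind *)

Section FirstKind.
Variables (n : nat) (mu : 'I_2 -> nat).
Notation filling := {ffun box mu -> 'I_n}.

Definition reading_pos (p : box mu) : nat :=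
  (bcol p + (if brow p == ord0 then 0 else mu ord0))%N.

Lemma card_reading_pos (P : pred nat) :
  #|[set p : box mu | P (reading_pos p)]| =
  #|[set x : 'I_(mu ord0 + mu ord_max) | P x]|.
Proof.
have row i : #|[set p : box mu | P (reading_pos p) && (brow p == i)]| =
    #|[set c : 'I_(mu i) | P (c + (if i == ord0 then 0 else mu ord0))%N]|.
  rewrite -(@card_row_cols _ mu i (fun c => P (c + (if i == ord0 then 0 else mu ord0))%N)).
  by apply: eq_card => p; rewrite !inE andbC; case: (eqVneq (brow p) i) => //= <-.
rewrite -[LHS]sum1dep_card (partition_big (@brow _ mu) predT) //=.
under eq_bigr do rewrite sum1dep_card row.
rewrite big_ord_recl big_ord1 -[RHS]sum1dep_card big_mkcond big_split_ord /=.
rewrite -!big_mkcond !sum1dep_card (_ : lift ord0 ord0 = ord_max); last exact: val_inj.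
by congr (_ + _)%N; apply: eq_card => c; rewrite !inE /= ?addn0 // addnC.
Qed.

Lemma reading_pos_ltn (p : box mu) : (reading_pos p < mu ord0 + mu ord_max)%N.
Proof.
rewrite /reading_pos; case: (row_mu p) => rp; rewrite rp /=.
  by rewrite addn0 ltn_addr // -rp /bcol; case: p {rp} => i [].
by rewrite addnC ltn_add2l; apply: bcol_bottom.
Qed.

(** The boxes are filled row after row with the weakly increasing word of content [a]. Its block of
    smallest letters covers the first [mu ord_max] boxes and does not reach the second row. *)
Lemma first_kind_ex (a : 'I_n -> nat) (i0 : 'I_n) : i0 = 0 :> nat ->
  (\sum_i a i = mu ord0 + mu ord_max)%N -> (mu ord_max <= a i0 <= mu ord0)%N ->
  exists tau : filling, first_kind a tau.
Proof.
move=> i00 asum /andP[a1 a2].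
have pos_lt p : (reading_pos p < \sum_i a i)%N by rewrite asum reading_pos_ltn.
have a0 : psum a 1 = a i0.
  by have -> : 1%N = i0.+1; rewrite ?psumS i00 ?psum0.
pose tau : filling := [ffun p => letter (pos_lt p)].
have tau_ltn p k : (tau p < k)%N = (reading_pos p < psum a k)%N.
  by rewrite ffunE letter_ltn.
exists tau; apply/and3P; split; apply/forallP.
- move=> k; apply/eqP; rewrite -(addKn (psum a k) (a k)) -psumS.
  rewrite -(@card_ord_interval (mu ord0 + mu ord_max)); last first.
    by rewrite -asum -psum_all leq_psum.
  rewrite -(card_reading_pos (fun x => psum a k <= x < psum a k.+1)%N).
  apply: eq_card => p; rewrite !inE -tau_ltn leqNgt -tau_ltn -leqNgt ltnS.
  by rewrite -val_eqE eqn_leq andbC.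
- move=> p; apply/implyP => bp; rewrite lt0n -leqn0 -ltnS tau_ltn a0 -leqNgt.
  by rewrite /reading_pos (negbTE bp); apply: leq_trans a2 (leq_addl _ _).
- move=> p; apply/implyP => /andP[bp cp]; rewrite -leqn0 -ltnS tau_ltn a0.
  by rewrite /reading_pos bp addn0; apply: leq_trans cp a1.
Qed.

Hypothesis mu_part : (mu ord_max <= mu ord0)%N.

Lemma first_kind_col_inj a (tau : filling) : first_kind a tau ->
  forall p q, bcol p = bcol q -> tau p = tau q -> p = q.
Proof.
case/and3P => _ /forallP tb /forallP tt.
have diff p q : brow p = ord0 -> brow q = ord_max -> bcol p = bcol q -> tau p <> tau q.
  move=> rp rq pq e; move: (tt p) (tb q); rewrite rp rq pq bcol_bottom //= -e.
  by move/eqP ->.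
move=> p q pq e; apply: box_inj => //.
case: (row_mu p) (row_mu q) => [] rp [] rq; rewrite ?rp ?rq //.
  by case: (diff p q).
by case: (diff q p).
Qed.

(** With unit vectors the sum counts the fillings of first kind with column sets [S]. There is only
    [tau], because in a column of height two the smallest letter has to be on top. *)
Lemma colform_unit_first_kind (R : comNzRingType) a (tau : filling) :
  first_kind a tau -> exists S : ext_basis n mu,
  \sum_(tau' : filling | first_kind a tau')
     colform S (fun p k => (tau' p == k)%:R) = 1 :> R.
Proof.
move=> tk; have [S TS] := has_columns_ex (first_kind_col_inj tk); exists S.
have one (t T : filling) : \prod_p (t p == T p)%:R = (t == T)%:R :> R.
  case: eqP => [->|ne]; first by rewrite big1 // => p _; rewrite eqxx.
  case: (pickP (fun p => t p != T p)) => [p h|h].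
    by rewrite (bigD1 p) //= (negbTE h) mul0r.
  by case: ne; apply/ffunP => p; apply/eqP; move: (h p) => /negbFE.
rewrite /colform exchange_big (bigD1 tau) //= [X in _ + X]big1 ?addr0.
  by rewrite (bigD1 tau) //= one eqxx big1 ?addr0 // => t /andP[_ /negbTE ne]; rewrite one ne.
move=> T /andP[TS' ne]; rewrite big1 // => t tk'; rewrite one; case: eqP => // e.
case/eqP: ne; subst t; apply/ffunP => p.
move/and3P: tk => [_ /forallP tb /forallP tt].
move/and3P: tk' => [_ /forallP tb' /forallP tt'].
have /imsetP[q] : T p \in [set tau q | q in [set q | bcol q == bcol p]].
  move/forallP: TS => /(_ (Ordinal (bcol_ltn p)))/eqP/= <-.
  move/forallP: TS' => /(_ (Ordinal (bcol_ltn p)))/eqP/= ->.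
  by apply/imsetP; exists p; rewrite // inE.
rewrite inE => /eqP qp Tpq; suff e : brow p = brow q by rewrite Tpq (box_inj e (esym qp)).
case: (row_mu p) (row_mu q) => rp [] rq; rewrite ?rp ?rq //.
  move: (tt' p) (tb q); rewrite rp rq -qp bcol_bottom //= Tpq.
  by move=> /eqP ->.
move: (tb' p) (tt q); rewrite rp rq qp bcol_bottom //= Tpq.
by move=> h /eqP e; rewrite e in h.
Qed.

End FirstKind.

(** * The partition with parts a, b and d ones *)

Section HookTail.
Variables (K : fieldType) (charK : 2%N \in [pchar K]) (n a b d : nat).
Variables (lam : 'I_n -> nat) (mu : 'I_2 -> nat).
Hypothesis lamE : forall i, lam i = nth 0%N (a :: b :: nseq d 1%N) i.
Hypothesis mu0 : mu ord0 = (a + d)%N.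
Hypothesis mu1 : mu ord_max = b.
Hypothesis n_ge : (d.+2 <= n)%N.
Hypothesis ab : (b <= a)%N.
Hypothesis lam_sum : (\sum_i lam i = mu ord0 + mu ord_max)%N.
Hypotheses (b2 : (2 <= b)%N) (d2 : (2 <= d)%N).

Let mu_part : (mu ord_max <= mu ord0)%N.
Proof. by rewrite mu0 mu1; lia. Qed.

Let lam0 (i : 'I_n) : i = 0 :> nat -> (mu ord_max <= lam i)%N.
Proof. by rewrite lamE mu1 => ->. Qed.

Let i0 : 'I_n := Ordinal (leq_trans (ltn0Sn d.+1) n_ge).
Let i1 : 'I_n := Ordinal (leq_trans (ltn0Sn d : (1 < d.+2)%N) n_ge).
Fact lt2n : (2 < n)%N.
Proof. by apply: leq_trans n_ge; lia. Qed.
Let i2 : 'I_n := Ordinal lt2n.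

Lemma sum_sq_wt (x : sq_index lam) : (\sum_i sq_wt x i = \sum_i lam i)%N.
Proof.
have sn : sq_s1 x != sq_s x by rewrite eq_sym sq_s_neq.
rewrite (bigD1 (sq_s x)) // [RHS](bigD1 (sq_s x)) //=.
rewrite (bigD1 (sq_s1 x)) //= [X in (_ = _ + X)%N](bigD1 (sq_s1 x)) //= !addnA.
congr (_ + _)%N.
  by rewrite /sq_wt !eqxx eq_sym sq_s_neq; have := sq_t_leq x; lia.
by apply: eq_bigr => i /andP[h1 h2]; rewrite /sq_wt (negbTE h1) (negbTE h2).
Qed.

Lemma sq_wt_s (x : sq_index lam) : sq_wt x (sq_s x) = (lam (sq_s x) + sq_t x)%N.
Proof. by rewrite /sq_wt eqxx. Qed.

(** The cases s = 1, s = 2 and s > 2. In the last two t = 1, since the parts from the third on are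
    at most 1. *)
Variant sq_index_spec (x : sq_index lam) : Prop :=
  | SqFirst of sq_s x = i0 & (sq_t x <= b)%N & row_shift_coef mu x = 'C(a - b + sq_t x, sq_t x)
  | SqSecond of sq_s x = i1 & row_shift_coef mu x = b.+1
  | SqTail of (1 < sq_s x)%N & row_shift_coef mu x = 2.

Lemma sq_indexP (x : sq_index lam) : sq_index_spec x.
Proof.
have tp : (0 < sq_t x)%N by [].
have := sq_t_leq x; rewrite lamE sq_s1E => tl.
have ce : row_shift_coef mu x =
   'C(lam (sq_s x) + sq_t x - (if sq_s x == 0 :> nat then b else 0), sq_t x).
  by rewrite /row_shift_coef sq_wt_s mu1.
case e : (nat_of_ord (sq_s x)) tl ce => [|[|s]] tl.
- rewrite lamE e /= => ce; apply: SqFirst => //; first exact: val_inj.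
  by rewrite ce; congr 'C(_, _); lia.
- rewrite lamE e /= subn0 => ce; apply: SqSecond; first exact: val_inj.
  have t1 : sq_t x = 1%N.
    apply/eqP; rewrite eqn_leq tp andbT; apply: leq_trans tl _ => /=.
    by rewrite nth_nseq; case: ifP.
  by rewrite ce t1 bin1 addn1.
move: tl; rewrite lamE e /= !nth_nseq; case: ifP => [sd t1|_]; last by lia.
rewrite (ltnW sd) subn0 => ce; apply: SqTail; first by rewrite e.
have {}t1 : sq_t x = 1%N by lia.
by rewrite ce t1 bin1.
Qed.

Lemma psiD_sq_eq0 (x : sq_index lam) : ~~ odd (row_shift_coef mu x) ->
  (psiD mu lam K \o sq_component K x)%VF = 0.
Proof.
have charP : 2%N \in [pchar {mpoly K[#|{: 'I_n * 'I_n}|]}].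
  exact: (rmorph_pchar (@mpolyC _ K)).
move=> cx; apply: ext_generic_eq0 => S; rewrite (ext_psiD_sq mu_part lam0 _ charP charK).
by rewrite (_ : _%:R = 0) ?mul0r //; apply/eqP; rewrite -(dvdn_pcharf charP) dvdn2.
Qed.

(** A filling of first kind would have more than [mu ord0] smallest letters, all of them in the
    first row. *)
Lemma psiD_sq_first_eq0 (x : sq_index lam) : sq_s x = i0 -> (d < sq_t x)%N ->
  (psiD mu lam K \o sq_component K x)%VF = 0.
Proof.
have charP : 2%N \in [pchar {mpoly K[#|{: 'I_n * 'I_n}|]}].
  exact: (rmorph_pchar (@mpolyC _ K)).
move=> xs td; apply: ext_generic_eq0 => S; rewrite (ext_psiD_sq mu_part lam0 _ charP charK).
rewrite big_pred0 ?mulr0 // => tau; apply/negbTE/negP => /and3P[/forallP tw /forallP tb _].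
move/eqP: (tw i0); rewrite -xs sq_wt_s xs lamE /=; apply/eqP; rewrite neq_ltn; apply/orP; left.
have le : (#|[set p | tau p == i0]| <= mu ord0)%N.
  rewrite -[leqRHS](subn0 (mu ord0)) -(card_ord_interval 0 (leqnn _)).
  rewrite -(@card_row_cols _ mu ord0 (fun c => 0 <= c < mu ord0)%N).
  apply: subset_leq_card; apply/subsetP => p; rewrite !inE => /eqP tp.
  case: (row_mu p) => rp; last by move: (tb p); rewrite rp tp.
  by rewrite rp eqxx /= -rp /bcol; case: p {tp rp} => i [].
by apply: leq_ltn_trans le _; rewrite mu0; lia.
Qed.

(** At unit vectors and suitable column sets, the value of the composite is the coefficient itself,
    read in [K]. The bounds provide a filling of first kind. *)
Lemma even_row_shift (x : sq_index lam) : (a <= sq_wt x i0)%N ->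
  (sq_wt x i0 <= mu ord0)%N ->
  (psiD mu lam K \o sq_component K x)%VF = 0 -> ~~ odd (row_shift_coef mu x).
Proof.
move=> w1 w2 h.
have [tau tk] : exists tau : {ffun box mu -> 'I_n}, first_kind (sq_wt x) tau.
  apply: (first_kind_ex (i0 := i0)) => //; first by rewrite sum_sq_wt lam_sum.
  by rewrite w2 andbT mu1; apply: leq_trans ab w1.
have [S one] := colform_unit_first_kind K tk.
have := @ext_psiD_sq n mu mu_part lam lam0 K K idfun charK charK x (fun i k => (i == k)%:R) S.
rewrite one h mulr1 /ext big1 => [e|A _]; last by rewrite lfunE ffunE rmorph0 mulr0.
by rewrite -dvdn2 (dvdn_pcharf charK) -e.
Qed.

Lemma square_iff : (forall x, (psiD mu lam K \o sq_component K x)%VF = 0) <->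
  [/\ ~~ odd a, odd b & (2 ^ l2 (minn b d) %| a - b + 1)%N].
Proof.
split=> [h|[ao bo dv] x]; last first.
  case: (sq_indexP x) => [xs tb c|xs c|_ c].
  - case: (leqP (sq_t x) d) => td; last exact: psiD_sq_first_eq0.
    apply: psiD_sq_eq0; rewrite c; apply: (proj2 (even_bins_l2 _ _) dv).
    by rewrite leq_min tb td.
  - by apply: psiD_sq_eq0; rewrite c /= bo.
  - by apply: psiD_sq_eq0; rewrite c.
have dv : (2 ^ l2 (minn b d) %| a - b + 1)%N.
  apply/even_bins_l2 => t /andP[t0]; rewrite leq_min => /andP[tb td].
  have [|x [xs xs1 xt]] := @sq_index_ex n lam i0 i1 t erefl; first by rewrite t0 lamE.
  have w : sq_wt x i0 = (a + t)%N by rewrite -xs sq_wt_s xs lamE xt.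
  have := even_row_shift _ _ (h x); rewrite w leq_addr mu0 leq_add2l td => /(_ isT isT).
  case: (sq_indexP x) => [_ _ ->|xs'|]; [by rewrite xt| |by rewrite xs].
  by have : i0 = i1 by rewrite -xs.
have bo : odd b.
  (* The component with s = 2 and t = 1 has coefficient b + 1. *)
  have [|x [xs xs1 xt]] := @sq_index_ex n lam i1 i2 1 erefl.
    by rewrite lamE /= nth_nseq (ltnW d2).
  have w : sq_wt x i0 = a by rewrite /sq_wt xs xs1 lamE.
  have := even_row_shift _ _ (h x); rewrite w leqnn mu0 leq_addr => /(_ isT isT).
  case: (sq_indexP x) => [xs' _|_ ->|]; [|by rewrite /= negbK|by rewrite xs].
  by have : i0 = i1 by rewrite -xs'.
(* As [minn b d] is positive, a - b + 1 is even; since b is odd, a is even. *)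
split=> //; move: dv; have : (2 %| 2 ^ l2 (minn b d))%N.
  rewrite -{1}(expn1 2); apply: dvdn_exp2l; rewrite ltnNge l2_leq -ltnNge expn0.
  by rewrite ltnS leq_min (ltnW b2) (ltnW d2).
move=> /dvdn_trans h2 /h2; rewrite dvdn2 oddD oddB // bo.
by case: (odd a).
Qed.

Lemma psiD_neq0 : psiD mu lam K != 0.
Proof.
have [tau tk] : exists tau : {ffun box mu -> 'I_n}, first_kind lam tau.
  apply: (first_kind_ex (i0 := i0)) => //.
  by rewrite lamE /= mu0 mu1 ab leq_addr.
have [S one] := colform_unit_first_kind K tk.
apply/eqP => h.
have := @ext_psiD_first_kind n mu mu_part lam lam0 K K idfun charK charK (fun i k => (i == k)%:R) S.
rewrite one h /ext big1 => [e|A _]; last by rewrite lfunE ffunE rmorph0 mulr0.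
by move: (oner_neq0 K); rewrite -e eqxx.
Qed.

Lemma limg_square_psi :
  (limg (square K lam) <= lker (psi K lam mu))%VS <->
  (forall x, (psiD mu lam K \o sq_component K x)%VF = 0).
Proof.
rewrite -limg_square_sub; split=> /subvP h; apply/subvP => v /h;
  by rewrite !memv_ker psi_eq0.
Qed.

Hypothesis lam_part : forall i j : 'I_n, (i <= j)%N -> (lam j <= lam i)%N.

(** Vanishing on the components of [square] makes [psiD] invariant under shears with parameter 1,
    hence zero on the kernel of the projection onto the Weyl module. *)
Lemma psi_factor : (limg (square K lam) <= lker (psi K lam mu))%VS ->
  exists2 f : 'Hom(Weyl K n lam, Weyl K n mu),
    psi K lam mu = (f \o piWeyl K n lam)%VF & f != 0.
Proof.
move=> /limg_square_psi h.
have sub : (lker (dprime K n lam) <= lker (psiD mu lam K))%VS.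
  apply: ker_dprime_sub => // s s1 v c ss.
  rewrite (eq_ext _ _ (fun A => dpow_shear (@mpolyC _ K) 1 v A ss)) extD ext_sumr big1 ?addr0 //.
  move=> x _; rewrite -ext_comp h /ext big1 ?mulr0 // => A _.
  by rewrite lfunE ffunE rmorph0 mulr0.
have piE x : (piWeyl K n lam x == 0) = (dprime K n lam x == 0).
  rewrite /piWeyl lfunE /=; apply/eqP/eqP => [e|->]; last by rewrite linear0.
  have := congr1 vsval e; rewrite vsprojK ?linear0 // memv_img ?memvf //.
(* The inverse of [piWeyl] is a linear section over its image; by [sub], the value of psi does not
   depend on the preimage chosen. *)
have psiE : psi K lam mu = ((psi K lam mu \o (piWeyl K n lam)^-1) \o piWeyl K n lam)%VF.
  apply/lfunP => x; rewrite !comp_lfunE; apply/eqP; rewrite -subr_eq0 -linearB psi_eq0.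
  rewrite -memv_ker; apply: (subvP sub); rewrite memv_ker -piE linearB /= subr_eq0.
  by rewrite eq_sym limg_lfunVK ?memv_img ?memvf.
exists (psi K lam mu \o (piWeyl K n lam)^-1)%VF => //.
apply/eqP => f0; case/eqP: psiD_neq0; apply/lfunP => x.
by apply/eqP; rewrite [X in _ == X]lfunE -psi_eq0 psiE f0 comp_lfun0l lfunE.
Qed.

End HookTail.

Theorem corollary9p6 (K : fieldType) (n r a b d : nat)
    (lam : 'I_n -> nat) (mu : 'I_2 -> nat) :
  infinite_field K -> 2%N \in [pchar K] ->
  (0 < r)%N -> (r <= n)%N ->
  lam = wt (a :: b :: nseq d 1%N) -> Lambda_plus r lam ->
  mu = wt [:: (a + d)%N; b] -> Lambda_plus r mu ->
  (2 <= b)%N -> (2 <= d)%N ->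
  [<-> (limg (square K lam) <= lker (psi K lam mu))%VS;
       [/\ ~~ odd a, odd b & (2 ^ l2 (minn b d) %| a - b + 1)%N];
       [/\ ~~ odd a, odd b & max_two_complement (minn b d) (a - b)%N 0]]
  /\
  ((limg (square K lam) <= lker (psi K lam mu))%VS ->
   exists2 f : 'Hom(Weyl K n lam, Weyl K n mu),
     psi K lam mu = (f \o piWeyl K n lam)%VF & f != 0).
Proof.
move=> _ charK _ rn lamE [lam_r lam_part] muE [mu_r _] b2 d2.
have lamE' i : lam i = nth 0%N (a :: b :: nseq d 1%N) i by rewrite lamE.
have mu0 : mu ord0 = (a + d)%N by rewrite muE.
have mu1 : mu ord_max = b by rewrite muE.
have rE : r = (mu ord0 + mu ord_max)%N.
  by rewrite -mu_r big_ord_recl big_ord1; congr (_ + mu _)%N; apply: val_inj.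
have n_ge : (d.+2 <= n)%N by apply: leq_trans rn; rewrite rE mu0 mu1; lia.
have ab : (b <= a)%N.
  have n1 : (1 < n)%N by apply: leq_trans n_ge.
  by have := lam_part (Ordinal (ltnW n1)) (Ordinal n1) isT; rewrite !lamE'.
have lam_sum : (\sum_i lam i = mu ord0 + mu ord_max)%N by rewrite -rE.
have sq_iff := square_iff charK lamE' mu0 mu1 n_ge ab lam_sum b2 d2.
have psi_iff := limg_square_psi K lam mu.
have l2_iff := @max_two_complement0 (minn b d) (a - b).
split; last exact: (psi_factor charK lamE' mu0 mu1 n_ge ab lam_sum).
have m2 : (2 <= minn b d)%N by rewrite leq_min b2.
tfae.
- by move=> /psi_iff /sq_iff.
- by case=> ao bo /(l2_iff m2) h; split.
- by case=> ao bo /(l2_iff m2) h; apply/psi_iff/sq_iff; split.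
Qed.
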